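(* Let $\bar x$ be feasible for $MPEC(\bar\omega)$. Consider, for $u\in T^{\rm lin}_{\bar\omega}(\bar x)$, $\lambda=(\lambda^g,\lambda^h,\lambda^G,\lambda^H)$ and $\mu=(\mu^g,\mu^h,\mu^G,\mu^H)$ in $\mathbb R^{m_I}\times\mathbb R^{m_E}\times\mathbb R^{m_C}\times\mathbb R^{m_C}$ and $\nu\in\mathbb R^n$, the following conditions: (1) $\lambda^g_i\ge0$ for $i\in I_g(u)$, $\lambda^g_i=0$ for $i\notin I_g(u)$; (2) $\lambda^H_i=0$ for $i\in\bar I^{0+}\cup I^{0+}(u)$, $\lambda^G_i=0$ for $i\in\bar I^{+0}\cup I^{+0}(u)$; (3) either $\lambda^G_i>0,\lambda^H_i>0$ or $\lambda^G_i\lambda^H_i=0$, for $i\in I^{00}(u)$; (4) $\mu^g_i\ge0$ for $i\in I_g(u)$ with $\lambda^g_i=0$, $\mu^g_i=0$ for $i\notin I_g(u)$; (5) $\mu^H_i=0$ for $i\in\bar I^{0+}\cup I^{0+}(u)$, $\mu^G_i=0$ for $i\in\bar I^{+0}\cup I^{+0}(u)$; (6) either $\mu^G_i>0,\mu^H_i>0$ or $\mu^G_i\mu^H_i=0$, for $i\in I^{00}(u)$ with $\lambda^G_i=\lambda^H_i=0$; (7) $\mu^G_i\ge0$ for $i\in I^{00}(u)$ with $\lambda^G_i=0,\lambda^H_i>0$, and $\mu^G_i=0$ for $i\in I^{00}(u)$ with $\lambda^G_i=0,\lambda^H_i<0$; (8) $\mu^H_i\ge0$ for $i\in I^{00}(u)$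 with $\lambda^H_i=0,\lambda^G_i>0$, and $\mu^H_i=0$ for $i\in I^{00}(u)$ with $\lambda^H_i=0,\lambda^G_i<0$; (9) $\nabla_x\mathcal L^1(\bar x,\lambda,\bar\omega)=0$; (10) $\nabla_x^2\mathcal L^1(\bar x,\lambda,\bar\omega)u+\nabla_x\mathcal L^0(\bar x,\mu,\bar\omega)=0$; (11) $\nabla_xg_i(\bar x,\bar\omega)\nu+u^T\nabla_x^2g_i(\bar x,\bar\omega)u\le0$ for $i\in\bar I_g$; (12) $\nabla_xh_i(\bar x,\bar\omega)\nu+u^T\nabla_x^2h_i(\bar x,\bar\omega)u=0$ for $i=1,\dots,m_E$; (13) $\nabla_xG_i(\bar x,\bar\omega)\nu+u^T\nabla_x^2G_i(\bar x,\bar\omega)u=0$ for $i\in\bar I^{0+}\cup I^{0+}(u)$; (14) $\nabla_xH_i(\bar x,\bar\omega)\nu+u^T\nabla_x^2H_i(\bar x,\bar\omega)u=0$ for $i\in\bar I^{+0}\cup I^{+0}(u)$; (15) $-\big(\nabla_xG_i(\bar x,\bar\omega)\nu+u^T\nabla_x^2G_i(\bar x,\bar\omega)u,\ \nabla_xH_i(\bar x,\bar\omega)\nu+u^T\nabla_x^2H_i(\bar x,\bar\omega)u\big)\in T((0,0);Q_{EC})$ for $i\in I^{00}(u)$; (16) $u^T\nabla_x^2\mathcal L^0(\bar x,\lambda,\bar\omega)u=\nabla_xf(\bar x,\bar\omega)\nu$. 1. If property $R_1$ holds and there do not exist $0\neq u\in T^{\rm lin}_{\bar\omega}(\bar x)$,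 $\lambda$ and $\mu$ satisfying (1)-(10), then there are neighborhoods $U$ of $\bar x$, $W$ of $\bar\omega$ and a constant $L>0$ such that $$(S(\omega)\cup S_M(\omega))\cap U\subset\bar x+L\tau_1(\omega)\mathcal B_{\mathbb R^n}\quad\forall\omega\in W.$$ 2. If property $R_2$ holds and there do not exist $0\neq u\in T^{\rm lin}_{\bar\omega}(\bar x)$, $\lambda$, $\mu$ and $\nu$ satisfying (1)-(16), then there are neighborhoods $U$ of $\bar x$, $W$ of $\bar\omega$ and a constant $L>0$ such that $$(S(\omega)\cup S_M(\omega))\cap U\subset\bar x+L\tau_2(\omega)\mathcal B_{\mathbb R^n}\quad\forall\omega\in W.$$
   Context: Problem. $\Omega$ is a topological space, $\bar\omega\in\Omega$; $f:\mathbb R^n\times\Omega\to\mathbb R$, $g:\mathbb R^n\times\Omega\to\mathbb R^{m_I}$, $h:\mathbb R^n\times\Omega\to\mathbb R^{m_E}$, $G,H:\mathbb R^n\times\Omega\to\mathbb R^{m_C}$ are continuous. $MPEC(\omega)$: minimize $f(x,\omega)$ over $x$ subject to $g(x,\omega)\le0$, $h(x,\omega)=0$, and $G_i(x,\omega)\ge0$, $H_i(x,\omega)\ge0$, $G_i(x,\omega)H_i(x,\omega)=0$ for $i=1,\dots,m_C$. Put $Q_{EC}:=\{(a,b)\in\mathbb R_-^2\mid ab=0\}$, $P:=\mathbb R_-^{m_I}\times\{0\}^{m_E}\times Q_{EC}^{m_C}$ and $q:=(g,h,-(G_1,H_1),\dots,-(G_{m_C},H_{m_C}))$, so the feasible set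 is $\mathcal F(\omega)=\{x\mid q(x,\omega)\in P\}$. $M_\omega(x):=q(x,\omega)-P$. $\|\cdot\|$ is the Euclidean norm (and the associated operator norm), $\mathcal B_{\mathbb R^n}$ the closed unit ball. Standing assumption. There are neighborhoods $U_0$ of $\bar x$ and $W_0$ of $\bar\omega$ such that $f$ and $q$ are twice partially differentiable with respect to $x$ on $U_0\times W_0$; $q,\nabla_xf,\nabla_xq,\nabla_x^2f,\nabla_x^2q$ are continuous at $(\bar x,\bar\omega)$; and $\nabla_x^2f(\cdot,\omega)$, $\nabla_x^2q(\cdot,\omega)$ are continuous on $U_0$ for every $\omega\in W_0$. Index sets. $\bar I_g:=\{i\mid g_i(\bar x,\bar\omega)=0\}$; $\bar I^{+0}:=\{i\mid G_i(\bar x,\bar\omega)>0=H_i(\bar x,\bar\omega)\}$; $\bar I^{0+}:=\{i\mid G_i(\bar x,\bar\omega)=0<H_i(\bar x,\bar\omega)\}$; $\bar I^{00}:=\{i\mid G_i(\bar x,\bar\omega)=0=H_i(\bar x,\bar\omega)\}$. The linearized cone $T^{\rm lin}_{\bar\omega}(\bar x)$ is the set of all $u\in\mathbb R^n$ with $\nabla_xg_i(\bar x,\bar\omega)u\le0$ ($i\in\bar I_g$), $\nabla_xh_i(\bar x,\bar\omega)u=0$ ($i=1,\dots,m_E$), $\nabla_xG_i(\bar x,\bar\omega)u=0$ ($i\in\bar I^{0+}$), $\nabla_xH_i(\bar x,\bar\omega)u=0$ ($i\in\bar I^{+0}$), $-(\nabla_xG_i(\bar x,\bar\omega)u,\nabla_xH_i(\bar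 x,\bar\omega)u)\in Q_{EC}$ ($i\in\bar I^{00}$). For such $u$: $I_g(u):=\{i\in\bar I_g\mid\nabla_xg_i(\bar x,\bar\omega)u=0\}$; $I^{+0}(u):=\{i\in\bar I^{00}\mid\nabla_xG_i(\bar x,\bar\omega)u>0=\nabla_xH_i(\bar x,\bar\omega)u\}$; $I^{0+}(u):=\{i\in\bar I^{00}\mid\nabla_xG_i(\bar x,\bar\omega)u=0<\nabla_xH_i(\bar x,\bar\omega)u\}$; $I^{00}(u):=\{i\in\bar I^{00}\mid\nabla_xG_i(\bar x,\bar\omega)u=0=\nabla_xH_i(\bar x,\bar\omega)u\}$. Extended Lagrangian. For $\lambda_0\in\mathbb R$ and $\lambda=(\lambda^g,\lambda^h,\lambda^G,\lambda^H)$, $$\mathcal L^{\lambda_0}(x,\lambda,\omega):=\lambda_0f(x,\omega)+\sum_{i=1}^{m_I}\lambda^g_ig_i(x,\omega)+\sum_{i=1}^{m_E}\lambda^h_ih_i(x,\omega)-\sum_{i=1}^{m_C}\big(\lambda^G_iG_i(x,\omega)+\lambda^H_iH_i(x,\omega)\big).$$ Cones. For $\Gamma\subset\mathbb R^d$, $x\in\Gamma$: $T(x;\Gamma):=\{u\mid\exists u_k\to u,\ t_k\downarrow0:\ x+t_ku_k\in\Gamma\}$; $\hat N(x;\Gamma):=\{\xi\mid\limsup_{x'\to x,\,x'\in\Gamma}\xi^T(x'-x)/\|x'-x\|\le0\}$; $N(x;\Gamma):=\{\xi\mid\exists x_k\to x,\ x_k\in\Gamma,\ \xi_k\to\xi:\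 \xi_k\in\hat N(x_k;\Gamma)\}$; all empty if $x\notin\Gamma$. Stationary solution maps of $MPEC(\omega)$. $S(\omega):=\{x\mid0\in\nabla_xf(x,\omega)+\hat N(x;\mathcal F(\omega))\}$ and $S_M(\omega):=\{x\mid0\in\nabla_xf(x,\omega)+\nabla_xq(x,\omega)^TN(q(x,\omega);P)\}$ (only points near $\bar x$, where the derivatives exist, matter). For $l\in\{1,2\}$: $e_l(\omega):=\|\nabla_xq(\bar x,\omega)-\nabla_xq(\bar x,\bar\omega)\|+\|q(\bar x,\omega)-q(\bar x,\bar\omega)\|^{1/l}$, $\tau_l(\omega):=\|\nabla_xf(\bar x,\omega)-\nabla_xf(\bar x,\bar\omega)\|+e_l(\omega)$. Property $R_l$ holds if there are neighborhoods $U$ of $\bar x$, $W$ of $\bar\omega$ and constants $\kappa,\gamma>0$ such that for every $\omega\in W$ and every $x\in\mathcal F(\omega)\cap U$ with $\|x-\bar x\|>\gamma e_l(\omega)$ the multifunction $M_\omega$ is metrically regular with modulus $\kappa$ around $(x,0)$, i.e. there are neighborhoods $U'$ of $x$ and $V'$ of $0$ with ${\rm d}(x',M_\omega^{-1}(y))\le\kappa\,{\rm d}(y,M_\omega(x'))$ for all $(x',y)\in U'\times V'$. *)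

(* Defs.v *)
From HB Require Import structures.
From mathcomp Require Import all_boot all_order all_algebra.
From mathcomp Require Import all_classical all_reals all_analysis.
Set Implicit Arguments.
Unset Strict Implicit.
Unset Printing Implicit Defensive.
Import Order.TTheory GRing.Theory Num.Theory.
Import numFieldNormedType.Exports.
Local Open Scope classical_set_scope.
Local Open Scope ring_scope.

(* Points of R^d are row vectors. The library norm on 'rV[R]_d is the sup norm:
   it is used only through the topology and differentiability it induces (which
   do not depend on the norm); all metric quantities use the Euclidean norm. *)
Section Euclidean.
Variable R : realType.

Definition dot (d : nat) (u v : 'rV[R]_d) : R := (u *m v^T) 0 0.

Definition enorm (d : nat) (u : 'rV[R]_d) : R := Num.sqrt (dot u u).

Definition eball (d : nat) : set 'rV[R]_d := [set b | enorm b <= 1].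

(* Operator norm, for the Euclidean norms, of the linear map v |-> v *m A. *)
Definition opnorm (n m : nat) (A : 'M[R]_(n, m)) : R :=
  sup [set enorm (v *m A) | v in @eball n].

(* Extended-real valued, so that the distance to the empty set is +oo. *)
Definition edistance (d : nat) (x : 'rV[R]_d) (A : set 'rV[R]_d) : \bar R :=
  ereal_inf [set (enorm (x - a))%:E | a in A].

Definition row2 (a b : R) : 'rV[R]_2 := \row_(j < 2) (if j == 0 then a else b).

End Euclidean.

Section Cones.
Variables (R : realType) (d : nat).
Implicit Types (x : 'rV[R]_d) (C : set 'rV[R]_d).

Definition tangent_cone x C : set 'rV[R]_d :=
  [set u | C x /\ exists (us : nat -> 'rV[R]_d) (t : nat -> R),
     [/\ us k @[k --> \oo] --> u, (forall k, 0 < t k),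
         t k @[k --> \oo] --> (0 : R) & forall k, C (x + t k *: us k)]].

Definition regular_normal_cone x C : set 'rV[R]_d :=
  [set xi | C x /\
     (limf_esup (fun x' => (dot xi (x' - x) / enorm (x' - x))%:E)
                (within C x^') <= 0%:E)%E].

Definition limiting_normal_cone x C : set 'rV[R]_d :=
  [set xi | C x /\ exists (xs xis : nat -> 'rV[R]_d),
     [/\ xs k @[k --> \oo] --> x, (forall k, C (xs k)),
         xis k @[k --> \oo] --> xi &
         forall k, regular_normal_cone (xs k) C (xis k)]].

End Cones.

Section MetricRegularity.
Variables (R : realType) (n m : nat).

Definition metrically_regular (M : 'rV[R]_n -> set 'rV[R]_m) (kappa : R)
    (x : 'rV[R]_n) (y : 'rV[R]_m) : Prop :=
  exists (U : set 'rV[R]_n) (V : set 'rV[R]_m), [/\ nbhs x U, nbhs y V &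
    forall x' y', U x' -> V y' ->
      (edistance x' [set z | M z y'] <= kappa%:E * edistance y' (M x'))%E].

End MetricRegularity.

Section Derivatives.
Variables (R : realType) (n : nat).

Definition grad (phi : 'rV[R]_n -> R) (x : 'rV[R]_n) : 'rV[R]_n :=
  \row_j 'd phi x (delta_mx 0 j).

(* As for the library's jacobian, u *m hess phi x is the derivative of
   grad phi at x in the direction u. *)
Definition hess (phi : 'rV[R]_n -> R) (x : 'rV[R]_n) : 'M[R]_n :=
  jacobian (grad phi) x.

Definition quad (A : 'M[R]_n) (u : 'rV[R]_n) : R := dot (u *m A) u.

End Derivatives.

Record mpec (R : realType) (Omega : topologicalType) (n mI mE mC : nat) := Mpec {
  mf : 'rV[R]_n * Omega -> R;
  mg : 'rV[R]_n * Omega -> 'rV[R]_mI;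
  mh : 'rV[R]_n * Omega -> 'rV[R]_mE;
  mG : 'rV[R]_n * Omega -> 'rV[R]_mC;
  mH : 'rV[R]_n * Omega -> 'rV[R]_mC
}.

Record multiplier (R : realType) (mI mE mC : nat) := Multiplier {
  lg : 'rV[R]_mI;
  lh : 'rV[R]_mE;
  lG : 'rV[R]_mC;
  lH : 'rV[R]_mC
}.

Definition QEC (R : realType) : set 'rV[R]_2 :=
  [set z | [/\ z 0 0 <= 0, z 0 1 <= 0 & z 0 0 * z 0 1 = 0]].

Section MPEC.
Variables (R : realType) (Omega : topologicalType) (n mI mE mC : nat).
Variable p : mpec R Omega n mI mE mC.
Local Notation X := 'rV[R]_n.
Local Notation mult := (multiplier R mI mE mC).
Local Notation Y := 'rV[R]_(mI + (mE + (mC + mC))).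

(* The complementarity pairs are stored blockwise: all components -G_i first,
   then all components -H_i. This only permutes the coordinates. *)
Definition mq (z : X * Omega) : Y :=
  row_mx (mg p z) (row_mx (mh p z) (row_mx (- mG p z) (- mH p z))).

Definition Pset : set Y :=
  [set y | exists (a : 'rV[R]_mI) (b : 'rV[R]_mE) (c d : 'rV[R]_mC),
     [/\ y = row_mx a (row_mx b (row_mx c d)),
         (forall i, a 0 i <= 0), b = 0 &
         forall i, @QEC R (row2 (c 0 i) (d 0 i))]].

Definition feasible (w : Omega) : set X := [set x | Pset (mq (x, w))].

Definition Mmap (w : Omega) (x : X) : set Y := [set mq (x, w) - y | y in Pset].

Definition component (m : nat) (F : X * Omega -> 'rV[R]_m) (i : 'I_m) (w : Omega) :
  X -> R := fun x => F (x, w) 0 i.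

Definition gradf (x : X) (w : Omega) : X := grad (fun y => mf p (y, w)) x.

Definition hessf (x : X) (w : Omega) : 'M[R]_n :=
  hess (fun y => mf p (y, w)) x.

(* The transpose of the usual Jacobian matrix, since vectors are rows. *)
Definition jacq (x : X) (w : Omega) : 'M[R]_(n, mI + (mE + (mC + mC))) :=
  jacobian (fun y => mq (y, w)) x.

Definition mpec_continuous : Prop :=
  [/\ continuous (mf p), continuous (mg p), continuous (mh p),
      continuous (mG p) & continuous (mH p)].

(* Taking U0 open only shrinks it; it gives "differentiable on U0" its usual
   meaning also for the second derivatives. *)
Definition standing_assumption (xb : X) (wb : Omega) : Prop :=
  exists (U0 : set X) (W0 : set Omega), [/\ open_nbhs xb U0, nbhs wb W0,
    (forall x w, U0 x -> W0 w ->
      [/\ differentiable (fun y => mf p (y, w)) x,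
          differentiable (fun y => gradf y w) x,
          differentiable (fun y => mq (y, w)) x &
          differentiable (fun y => jacq y w) x]),
    [/\ {for (xb, wb), continuous mq},
        {for (xb, wb), continuous (fun z => gradf z.1 z.2)},
        {for (xb, wb), continuous (fun z => jacq z.1 z.2)},
        {for (xb, wb), continuous (fun z => hessf z.1 z.2)} &
        forall i, {for (xb, wb), continuous (fun z => hess (component mq i z.2) z.1)}] &
    forall w, W0 w -> forall x, U0 x ->
      {for x, continuous (fun y => hessf y w)} /\
      forall i, {for x, continuous (fun y => hess (component mq i w) y)}].

Definition lagrangian (l0 : R) (x : X) (l : mult) (w : Omega) : R :=
  l0 * mf p (x, w)
  + \sum_(i < mI) lg l 0 i * mg p (x, w) 0 i
  + \sum_(i < mE) lh l 0 i * mh p (x, w) 0 i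
  - \sum_(i < mC) (lG l 0 i * mG p (x, w) 0 i + lH l 0 i * mH p (x, w) 0 i).

Definition gradL (l0 : R) (x : X) (l : mult) (w : Omega) : X :=
  grad (fun y => lagrangian l0 y l w) x.

Definition hessL (l0 : R) (x : X) (l : mult) (w : Omega) : 'M[R]_n :=
  hess (fun y => lagrangian l0 y l w) x.

Definition Sol (w : Omega) : set X :=
  [set x | exists2 xi, regular_normal_cone x (feasible w) xi &
                       gradf x w + xi = 0].

Definition SolM (w : Omega) : set X :=
  [set x | exists2 eta, limiting_normal_cone (mq (x, w)) Pset eta &
                        gradf x w + eta *m (jacq x w)^T = 0].

Section AtReferencePoint.
Variables (xb : X) (wb : Omega).

Definition err (l : nat) (w : Omega) : R :=
  opnorm (jacq xb w - jacq xb wb)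
  + enorm (mq (xb, w) - mq (xb, wb)) `^ (l%:R^-1).

Definition tau (l : nat) (w : Omega) : R :=
  enorm (gradf xb w - gradf xb wb) + err l w.

Definition property_R (l : nat) : Prop :=
  exists (U : set X) (W : set Omega) (kappa gamma : R),
    [/\ nbhs xb U, nbhs wb W, 0 < kappa, 0 < gamma &
      forall w x, W w -> (feasible w `&` U) x ->
        enorm (x - xb) > gamma * err l w ->
        metrically_regular (Mmap w) kappa x 0].

Definition dg (i : 'I_mI) (v : X) : R := dot (grad (component (mg p) i wb) xb) v.
Definition dh (i : 'I_mE) (v : X) : R := dot (grad (component (mh p) i wb) xb) v.
Definition dG (i : 'I_mC) (v : X) : R := dot (grad (component (mG p) i wb) xb) v.
Definition dH (i : 'I_mC) (v : X) : R := dot (grad (component (mH p) i wb) xb) v.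

Definition d2g (i : 'I_mI) (u : X) : R := quad (hess (component (mg p) i wb) xb) u.
Definition d2h (i : 'I_mE) (u : X) : R := quad (hess (component (mh p) i wb) xb) u.
Definition d2G (i : 'I_mC) (u : X) : R := quad (hess (component (mG p) i wb) xb) u.
Definition d2H (i : 'I_mC) (u : X) : R := quad (hess (component (mH p) i wb) xb) u.

Definition Ig : set 'I_mI := [set i | mg p (xb, wb) 0 i = 0].
Definition Ip0 : set 'I_mC :=
  [set i | mG p (xb, wb) 0 i > 0 /\ mH p (xb, wb) 0 i = 0].
Definition I0p : set 'I_mC :=
  [set i | mG p (xb, wb) 0 i = 0 /\ 0 < mH p (xb, wb) 0 i].
Definition I00 : set 'I_mC :=
  [set i | mG p (xb, wb) 0 i = 0 /\ mH p (xb, wb) 0 i = 0].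

Definition Tlin : set X :=
  [set u | [/\ (forall i, Ig i -> dg i u <= 0),
               (forall i, dh i u = 0),
               (forall i, I0p i -> dG i u = 0),
               (forall i, Ip0 i -> dH i u = 0) &
               forall i, I00 i -> @QEC R (- row2 (dG i u) (dH i u))]].

Section AtDirection.
Variable u : X.

Definition Igu : set 'I_mI := [set i | Ig i /\ dg i u = 0].
Definition Ip0u : set 'I_mC := [set i | [/\ I00 i, dG i u > 0 & dH i u = 0]].
Definition I0pu : set 'I_mC := [set i | [/\ I00 i, dG i u = 0 & 0 < dH i u]].
Definition I00u : set 'I_mC := [set i | [/\ I00 i, dG i u = 0 & dH i u = 0]].

Record first_order_system (lam mu : mult) : Prop := {
  fo_lg : forall i, (Igu i -> 0 <= lg lam 0 i) /\ (~ Igu i -> lg lam 0 i = 0);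
  fo_lH0 : forall i, (I0p `|` I0pu) i -> lH lam 0 i = 0;
  fo_lG0 : forall i, (Ip0 `|` Ip0u) i -> lG lam 0 i = 0;
  fo_lGH : forall i, I00u i ->
    (0 < lG lam 0 i /\ 0 < lH lam 0 i) \/ lG lam 0 i * lH lam 0 i = 0;
  fo_mg : forall i, (Igu i -> lg lam 0 i = 0 -> 0 <= lg mu 0 i) /\
                    (~ Igu i -> lg mu 0 i = 0);
  fo_mH0 : forall i, (I0p `|` I0pu) i -> lH mu 0 i = 0;
  fo_mG0 : forall i, (Ip0 `|` Ip0u) i -> lG mu 0 i = 0;
  fo_mGH : forall i, I00u i -> lG lam 0 i = 0 -> lH lam 0 i = 0 ->
    (0 < lG mu 0 i /\ 0 < lH mu 0 i) \/ lG mu 0 i * lH mu 0 i = 0;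
  fo_mG : forall i, I00u i -> lG lam 0 i = 0 ->
    (0 < lH lam 0 i -> 0 <= lG mu 0 i) /\ (lH lam 0 i < 0 -> lG mu 0 i = 0);
  fo_mH : forall i, I00u i -> lH lam 0 i = 0 ->
    (0 < lG lam 0 i -> 0 <= lH mu 0 i) /\ (lG lam 0 i < 0 -> lH mu 0 i = 0);
  fo_stat : gradL 1 xb lam wb = 0;
  fo_dstat : u *m hessL 1 xb lam wb + gradL 0 xb mu wb = 0
}.

Record second_order_system (lam : mult) (nu : X) : Prop := {
  so_g : forall i, Ig i -> dg i nu + d2g i u <= 0;
  so_h : forall i, dh i nu + d2h i u = 0;
  so_G : forall i, (I0p `|` I0pu) i -> dG i nu + d2G i u = 0;
  so_H : forall i, (Ip0 `|` Ip0u) i -> dH i nu + d2H i u = 0;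
  so_GH : forall i, I00u i ->
    tangent_cone (row2 0 0) (@QEC R)
      (- row2 (dG i nu + d2G i u) (dH i nu + d2H i u));
  so_L : quad (hessL 0 xb lam wb) u = dot (gradf xb wb) nu
}.

End AtDirection.

End AtReferencePoint.
End MPEC.

(* Main.v *)
Require Import Defs.
From HB Require Import structures.
From mathcomp Require Import all_boot all_order all_algebra.
From mathcomp Require Import all_classical all_reals all_analysis.
From mathcomp Require Import ring lra.
Set Implicit Arguments.
Unset Strict Implicit.
Unset Printing Implicit Defensive.
Import Order.TTheory GRing.Theory Num.Theory.
Import numFieldNormedType.Exports.
Local Open Scope classical_set_scope.
Local Open Scope ring_scope.

(** If the bound fails for every constant, there are stationary points [x] for
    parameters [w], with [(x, w)] close to [(xb, wb)], such that [tau] is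
    negligible against the scale [t = |x - xb|]. Blow up at [xb] with this
    scale, and let [u] be the limit of the unit vectors [(x - xb) / t].

    Since [tau = o(t)], property R makes the constraint system metrically regular
    at [x], with a uniform modulus. This yields a multiplier at [x] for both
    notions of stationarity, up to the residual [t^2], and bounds it
    ([approximate_multiplier], from [preimage_approximate_normal] and
    [normal_bound]). Let [lam] be the limit of these multipliers. The difference
    of the stationarity equations at [x] and at [xb], divided by [t], contains
    the quotients (multiplier - [lam]) / [t], which may be unbounded. But
    their image under the reference gradients converges ([multiplier_increment]),
    and [conformal_limit] provides a vector [mu] with the limiting image whose
    nonzero entries have the signs of the entries of these quotients. This is the
    closedness of polyhedral cones under linear maps, in a form that keeps track
    of signs.

    When the shift of the constraints at [xb] is [o(t^2)], the constraints
    also have second-order expansions ([constraint_curvature]). The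
    displacement 2 ((x - xb) / t - [u]) / [t] may again be unbounded, and
    [conformal_limit], applied to it together with the scaled constraint values,
    gives [nu] and slacks with the signs of the constraint values at [x].

    What remains is combinatorial: the limits [u], [lam], [mu] and the slacks
    inherit their signs from constraint values and multipliers at a single
    nearby point, where feasibility and the normal cone of the complementarity
    set ([frechet_normal_signs]) dictate them ([Tlin_of_pattern],
    [first_order_of_pattern], [second_order_of_pattern]).

    The parameter space is an arbitrary topological space, and many limits have
    to be taken simultaneously; an ultrafilter of counterexamples replaces
    sequences and subsequences. *)

(** * The Euclidean norm and limits of matrices *)

Section EuclideanNorm.
Variable R : realType.

Lemma dotE d (u v : 'rV[R]_d) : dot u v = \sum_i u 0 i * v 0 i.
Proof. by rewrite /dot mxE; apply: eq_bigr => i _; rewrite mxE. Qed.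

Lemma dotC d (u v : 'rV[R]_d) : dot u v = dot v u.
Proof. by rewrite !dotE; apply: eq_bigr => i _; rewrite mulrC. Qed.

Lemma dotDl d (u v w : 'rV[R]_d) : dot (u + v) w = dot u w + dot v w.
Proof. by rewrite /dot mulmxDl mxE. Qed.

Lemma dotZl d a (u w : 'rV[R]_d) : dot (a *: u) w = a * dot u w.
Proof. by rewrite /dot -scalemxAl mxE. Qed.

Lemma dotDr d (u v w : 'rV[R]_d) : dot w (u + v) = dot w u + dot w v.
Proof. by rewrite !(dotC w) dotDl. Qed.

Lemma dotZr d a (u w : 'rV[R]_d) : dot w (a *: u) = a * dot w u.
Proof. by rewrite !(dotC w) dotZl. Qed.

Lemma dotNl d (u w : 'rV[R]_d) : dot (- u) w = - dot u w.
Proof. by rewrite -scaleN1r dotZl mulN1r. Qed.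

Lemma dotNr d (u w : 'rV[R]_d) : dot w (- u) = - dot w u.
Proof. by rewrite !(dotC w) dotNl. Qed.

Lemma dot0l d (w : 'rV[R]_d) : dot 0 w = 0.
Proof. by rewrite /dot mul0mx mxE. Qed.

Lemma dot0r d (w : 'rV[R]_d) : dot w 0 = 0.
Proof. by rewrite dotC dot0l. Qed.

Lemma dot_mulmx n d (u : 'rV[R]_n) (v : 'rV[R]_d) (A : 'M[R]_(n, d)) :
  dot (u *m A) v = dot u (v *m A^T).
Proof. by rewrite /dot trmx_mul trmxK mulmxA. Qed.

Lemma dot_delta d (u : 'rV[R]_d) j : dot u (delta_mx 0 j) = u 0 j.
Proof.
rewrite dotE (bigD1 j)//= big1 => [|i ij]; first by rewrite mxE !eqxx/= mulr1 addr0.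
by rewrite mxE (negbTE ij) andbF mulr0.
Qed.

Lemma dot_ge0 d (u : 'rV[R]_d) : 0 <= dot u u.
Proof. by rewrite dotE; apply: sumr_ge0 => i _; rewrite -expr2 sqr_ge0. Qed.

Lemma enorm_ge0 d (u : 'rV[R]_d) : 0 <= enorm u.
Proof. exact: sqrtr_ge0. Qed.

Lemma enorm_sqr d (u : 'rV[R]_d) : enorm u ^+ 2 = dot u u.
Proof. by rewrite sqr_sqrtr// dot_ge0. Qed.

Lemma coord_le_enorm d (u : 'rV[R]_d) i : `|u 0 i| <= enorm u.
Proof.
rewrite -ler_sqr ?nnegrE ?enorm_ge0 ?normr_ge0//.
rewrite enorm_sqr real_normK ?num_real// dotE (bigD1 i)//= -expr2 lerDl.
by apply: sumr_ge0 => j _; rewrite -expr2 sqr_ge0.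
Qed.

Lemma enorm_eq0 d (u : 'rV[R]_d) : enorm u = 0 -> u = 0.
Proof.
move=> u0; apply/rowP => i; rewrite mxE; apply/eqP.
by rewrite -normr_eq0 eq_le normr_ge0 -u0 coord_le_enorm.
Qed.

Lemma enorm0 d : enorm (0 : 'rV[R]_d) = 0.
Proof. by rewrite /enorm dot0l sqrtr0. Qed.

Lemma enormZ d a (u : 'rV[R]_d) : enorm (a *: u) = `|a| * enorm u.
Proof. by rewrite /enorm dotZl dotZr mulrA -expr2 sqrtrM ?sqr_ge0// sqrtr_sqr. Qed.

Lemma enormN d (u : 'rV[R]_d) : enorm (- u) = enorm u.
Proof. by rewrite -scaleN1r enormZ normrN1 mul1r. Qed.

Lemma enormB d (u v : 'rV[R]_d) : enorm (u - v) = enorm (v - u).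
Proof. by rewrite -enormN opprB. Qed.

Lemma cauchy_schwarz d (u v : 'rV[R]_d) : dot u v <= enorm u * enorm v.
Proof.
have [->|v0] := eqVneq v 0; first by rewrite dot0r enorm0 mulr0.
have [->|u0] := eqVneq u 0; first by rewrite dot0l enorm0 mul0r.
have pos w : w != 0 -> 0 < @enorm R d w.
  by move=> w0; rewrite lt_neqAle enorm_ge0 andbT; apply: contra w0 => /eqP/esym/enorm_eq0->.
have := dot_ge0 (enorm v *: u - enorm u *: v).
rewrite dotDl !dotDr !dotNl !dotNr !dotZl !dotZr -!enorm_sqr (dotC v u).
have := pos _ u0; have := pos _ v0; set a := enorm u; set b := enorm v.
move=> b0 a0 H.
have : 0 <= 2 * (a * b) * (a * b - dot u v) by move: H; set x := dot u v; lra.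
by rewrite pmulr_rge0 ?subr_ge0// mulr_gt0// mulr_gt0.
Qed.

Lemma cauchy_schwarz_abs d (u v : 'rV[R]_d) : `|dot u v| <= enorm u * enorm v.
Proof.
by rewrite ler_norml cauchy_schwarz lerNl -dotNl -(enormN u) cauchy_schwarz.
Qed.

Lemma enormD d (u v : 'rV[R]_d) : enorm (u + v) <= enorm u + enorm v.
Proof.
rewrite -ler_sqr ?nnegrE ?enorm_ge0 ?addr_ge0 ?enorm_ge0//.
rewrite enorm_sqr dotDl !dotDr -!enorm_sqr (dotC v u) sqrrD.
by have := cauchy_schwarz u v; lra.
Qed.

Lemma enorm_le_sum d (u : 'rV[R]_d) : enorm u <= \sum_i `|u 0 i|.
Proof.
rewrite {1}[u]row_sum_delta.
elim/big_ind2: _ => [|x a y b xa yb|i _].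
- by rewrite enorm0.
- by apply: (le_trans (enormD _ _)); rewrite lerD.
- by rewrite enormZ /enorm dot_delta mxE !eqxx/= sqrtr1 mulr1.
Qed.

Lemma enorm_gt0 d (u : 'rV[R]_d) : u != 0 -> 0 < enorm u.
Proof.
by move=> u0; rewrite lt_neqAle enorm_ge0 andbT; apply: contra u0 => /eqP/esym/enorm_eq0->.
Qed.

Lemma normr_le_enorm d (u : 'rV[R]_d) : `|u| <= enorm u.
Proof.
rewrite -[`|u|]/(mx_norm u).
have [->|/mx_norm_neq0[[i j]/= ->]] := eqVneq (mx_norm u) 0; first exact: enorm_ge0.
by rewrite [i]ord1 coord_le_enorm.
Qed.

Lemma coord_le_normr m d (u : 'M[R]_(m, d)) i j : `|u i j| <= `|u|.
Proof.
rewrite -[`|u|]/(mx_norm u) mx_normrE.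
exact: (le_bigmax _ (fun k : 'I_m * 'I_d => `|u k.1 k.2|) (i, j)).
Qed.

Lemma enorm_le_normr d (u : 'rV[R]_d) : enorm u <= d%:R * `|u|.
Proof.
apply: (le_trans (enorm_le_sum _)).
apply: (le_trans (ler_sum _ (fun i _ => coord_le_normr u 0 i))).
by rewrite sumr_const card_ord mulr_natl.
Qed.

End EuclideanNorm.

Section MatrixLimits.
Variables (R : realType) (T : Type) (F : set_system T).
Context {FF : Filter F}.

Lemma cvg_rowP d (f : T -> 'rV[R]_d) (l : 'rV[R]_d) :
  (forall j, f z 0 j @[z --> F] --> l 0 j) <-> f z @[z --> F] --> l.
Proof.
split=> [H|fl j]; last first.
  by apply: (@cvg_comp _ _ _ f (fun M : 'rV[R]_d => M 0 j) _ _ _ fl); exact: coord_continuous.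
apply/cvgrPdist_le => e e0.
have : \forall z \near F, forall j, `|l 0 j - f z 0 j| <= e.
  by apply: filter_forall => j; move/cvgrPdist_le : (H j); apply.
apply: filterS => z hz.
rewrite -[`|_|]/(mx_norm (l - f z)).
have [->|/mx_norm_neq0[[i j]/= ->]] := eqVneq (mx_norm (l - f z)) 0; first exact: ltW.
by rewrite [i]ord1 !mxE.
Qed.

Lemma cvg_mulmx n d (f : T -> 'rV[R]_n) (l : 'rV[R]_n) (A : 'M[R]_(n, d)) :
  f z @[z --> F] --> l -> (f z *m A) @[z --> F] --> l *m A.
Proof.
move=> /cvg_rowP fl; apply/cvg_rowP => j; rewrite mxE.
under eq_fun do rewrite mxE.
by apply: (cvg_big add_continuous) => i _; apply: cvgM => //; exact: cvg_cst.
Qed.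

Lemma cvg_dot d (f g : T -> 'rV[R]_d) l m :
  f z @[z --> F] --> l -> g z @[z --> F] --> m ->
  dot (f z) (g z) @[z --> F] --> dot l m.
Proof.
move=> /cvg_rowP fl /cvg_rowP gm; rewrite dotE; under eq_fun do rewrite dotE.
by apply: (cvg_big add_continuous) => i _; apply: cvgM.
Qed.

Lemma cvg_enorm d (f : T -> 'rV[R]_d) l :
  f z @[z --> F] --> l -> enorm (f z) @[z --> F] --> enorm l.
Proof.
move=> fl; apply: (@cvg_comp _ _ _ (fun z => dot (f z) (f z)) Num.sqrt); last exact: sqrt_continuous.
exact: cvg_dot.
Qed.

Lemma cvg_enorm0 d (f : T -> 'rV[R]_d) :
  enorm (f z) @[z --> F] --> (0 : R) -> f z @[z --> F] --> (0 : 'rV[R]_d).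
Proof.
move=> f0; apply/norm_cvg0P.
apply: (@squeeze_cvgr _ _ _ _ (cst 0) (fun z => enorm (f z))) => //; last exact: cvg_cst.
by near=> z; rewrite normr_ge0 normr_le_enorm.
Unshelve. all: by end_near. Qed.

End MatrixLimits.

(** * Limits along ultrafilters and sign-preserving closedness *)

Section ScalarLimits.
Variables (R : realType) (T : Type) (F : set_system T).
Context {FF : ProperFilter F}.

Lemma limit_unique (V : normedModType R) (f : T -> V) (x y : V) :
  f z @[z --> F] --> x -> f z @[z --> F] --> y -> x = y.
Proof. by move=> fx fy; apply: norm_cvg_unique fx fy. Qed.

Lemma cvg_ge0 (f : T -> R) (l : R) :
  f z @[z --> F] --> l -> (\forall z \near F, 0 <= f z) -> 0 <= l.
Proof.
move=> fl f0; rewrite leNgt; apply/negP => l0.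
have [z [fz0]] := filter_ex (filterI f0 (cvgr_lt _ fl _ l0)).
by rewrite /= ltNge fz0.
Qed.

Lemma cvg_le0 (f : T -> R) (l : R) :
  f z @[z --> F] --> l -> (\forall z \near F, f z <= 0) -> l <= 0.
Proof.
move=> fl f0; rewrite -oppr_ge0; apply: (cvg_ge0 (cvgN fl)).
by apply: filterS f0 => z /=; rewrite oppr_ge0.
Qed.

Lemma cvg_eq0 (f : T -> R) (l : R) :
  f z @[z --> F] --> l -> (\forall z \near F, f z = 0) -> l = 0.
Proof.
move=> fl f0; apply: le_anti; apply/andP; split.
- by apply: (cvg_le0 fl); apply: filterS f0 => z /= ->.
- by apply: (cvg_ge0 fl); apply: filterS f0 => z /= ->.
Qed.

Lemma cvg_same_sign (f : T -> R) (l : R) :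
  f z @[z --> F] --> l -> l != 0 -> \forall z \near F, 0 < l * f z.
Proof.
move=> fl l0; have ll : 0 < l * l by rewrite -expr2 exprn_even_gt0.
exact: (cvgr_gt _ (cvgM (cvg_cst l) fl) _ ll).
Qed.

End ScalarLimits.

Section Ultrafilters.
Variables (R : realType) (T : Type) (G : set_system T).
Context {GU : UltraFilter G}.

(** Along an ultrafilter, boundedness gives convergence without passing to a
    subsequence, so that limits of several quantities can be taken at once. *)
Lemma ultra_cvg_bounded d (f : T -> 'rV[R]_d) (c : R) :
  (\forall z \near G, `|f z| <= c) -> exists l : 'rV[R]_d, f z @[z --> G] --> l.
Proof.
move=> fc.
have cptA : compact [set v : 'rV[R]_d | forall i, v ord0 i \in `[- c, c]].
  apply: (@rV_compact _  _ (fun=> `[- c, c]%classic)).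
  by move=> _; apply: segment_compact.
have [|l [_ cl]] := cptA (fmap f G) (fmap_proper_filter f ultra_proper).
  rewrite /fmap/=; apply: filterS fc => z /= fz i; rewrite in_itv/= -ler_norml.
  exact: le_trans (coord_le_normr _ _ _) fz.
exists l => A lA; have [//|GnA] := in_ultra_setVsetC (f @^-1` A) GU.
have [v [vA]] := cl (~` A) A GnA lA; by move=> /vA.
Qed.

(** [c] lies in the smallest closed face of an orthant that contains [a]. *)
Definition conformal d (c a : 'rV[R]_d) : Prop :=
  forall i, c 0 i != 0 -> 0 < c 0 i * a 0 i.

Lemma conformal_refl d (a : 'rV[R]_d) : conformal a a.
Proof. by move=> i ai; rewrite -expr2 exprn_even_gt0. Qed.

Lemma conformal_trans d (a b c : 'rV[R]_d) :
  conformal a b -> conformal b c -> conformal a c.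
Proof.
move=> ab bc i ai; have abi := ab i ai.
have bi : b 0 i != 0 by apply: contraTneq abi => ->; rewrite mulr0 ltxx.
have bci := bc i bi.
have : 0 < (a 0 i * b 0 i) * (b 0 i * c 0 i) by rewrite mulr_gt0.
have -> : (a 0 i * b 0 i) * (b 0 i * c 0 i) = b 0 i ^+ 2 * (a 0 i * c 0 i) by ring.
by rewrite pmulr_rgt0// exprn_even_gt0.
Qed.

(** An exact minimiser exists too; the slack [1] avoids a compactness argument
    and is harmless, since only large norms are compared below. *)
Lemma near_minimal_conformal d e (a : 'rV[R]_d) (B : 'M[R]_(d, e)) :
  exists c, [/\ conformal c a, c *m B = a *m B &
    forall c', conformal c' a -> c' *m B = a *m B -> `|c| <= `|c'| + 1].
Proof.
pose A := [set `|c| | c in [set c | conformal c a /\ c *m B = a *m B]].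
have A0 : A !=set0 by exists `|a|, a => //; split=> //; exact: conformal_refl.
have Ai : has_inf A by split=> //; exists 0 => _ [c _ <-].
have [_ [c [ca cB] <-] clt] := inf_adherent ltr01 Ai.
exists c; split=> // c' c'a c'B; apply: ltW; apply: (lt_le_trans clt).
by rewrite lerD2r; apply: ge_inf; [case: Ai|exists c'].
Qed.

(** The image of a face of an orthant under a linear map is closed, and the
    vectors [a z] need not be bounded. Replace [a z] by an almost shortest [c z]
    of the same face with the same image. If [c z] were unbounded, the limit [dd]
    of its directions would lie in the kernel of [B], and subtracting
    [(`|c z| / 2) *: dd] would nearly halve [c z] without leaving the face.
    Hence [c z] is bounded, and its limit has signs already present in [a z]. *)
Theorem conformal_limit d e (a : T -> 'rV[R]_d) (B : 'M[R]_(d, e)) w :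
  (a z *m B) @[z --> G] --> w ->
  exists2 mu, mu *m B = w & \forall z \near G, conformal mu (a z).
Proof.
move=> aBw.
have [c cP] := choice (fun z => near_minimal_conformal (a z) B).
have cBw : (c z *m B) @[z --> G] --> w.
  suff -> : (fun z => c z *m B) = (fun z => a z *m B) by [].
  by apply/funext => z; case: (cP z).
have [[M cM]|unb] := pselect (exists M, \forall z \near G, `|c z| <= M).
  have [mu cmu] := ultra_cvg_bounded cM.
  exists mu; first by apply: (@limit_unique _ _ G _ _ (fun z => c z *m B) _ _ _ cBw); exact: cvg_mulmx.
  have : \forall z \near G, conformal mu (c z).
    apply: filter_forall => i; have [i0|i0] := eqVneq (mu 0 i) 0.
      by apply: nearW.
    near=> z => _; near: z; apply: cvg_same_sign i0.
    by move/cvg_rowP : cmu.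
  apply: filterS => z /conformal_trans; apply.
  by case: (cP z).
have cinf M : \forall z \near G, M < `|c z|.
  have [GM|] := in_ultra_setVsetC [set z | `|c z| <= M] GU.
    by exfalso; apply: unb; exists M.
  by apply: filterS => z /= /negP; rewrite -ltNge.
pose d' z : 'rV[R]_d := `|c z|^-1 *: c z.
have d1 : \forall z \near G, `|d' z| = 1.
  near=> z; rewrite /d' normrZ gtr0_norm ?invr_gt0 ?mulVf//.
    by rewrite gt_eqF//; near: z; exact: cinf.
  by near: z; exact: cinf.
have [|dd d'd] := @ultra_cvg_bounded _ d' 1.
  by apply: filterS d1 => z ->.
have dB0 : dd *m B = 0.
  apply: (@limit_unique _ _ G _ _ (fun z => d' z *m B)); first exact: cvg_mulmx.
  have -> : (fun z => d' z *m B) = (fun z => `|c z|^-1 *: (c z *m B)).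
    by apply/funext => z; rewrite /d' -scalemxAl.
  rewrite -(scale0r w); apply: cvgZ => //.
  apply/cvgrPdist_le => eps e0; near=> z.
  rewrite sub0r normrN normfV normr_id.
  have cz : eps^-1 < `|c z| by near: z; exact: cinf.
  by rewrite -(invrK eps) lef_pV2 ?posrE ?invr_gt0// ?(ltW cz)// (lt_trans _ cz)// invr_gt0.
have nd1 : `|dd| = 1.
  apply: (@limit_unique _ _ G _ _ (fun z => `|d' z|)); first exact: cvg_norm.
  suff : (cst 1 : T -> R) z @[z --> G] --> (1 : R).
    by apply: cvg_trans; apply: near_eq_cvg; apply: filterS d1 => z /= ->.
  exact: cvg_cst.
exfalso.
have half : (d' z - 2^-1 *: dd) @[z --> G] --> 2^-1 *: dd.
  have e2 : dd - 2^-1 *: dd = 2^-1 *: dd.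
    by rewrite -{1}(scale1r dd) -scalerBl; congr (_ *: _); lra.
  by rewrite -[X in _ --> X]e2; apply: (cvgB d'd); exact: cvg_cst.
have confd : \forall z \near G, conformal (c z - (`|c z| / 2) *: dd) (c z).
  have : \forall z \near G, forall i, dd 0 i != 0 ->
      0 < (d' z - 2^-1 *: dd) 0 i * d' z 0 i.
    apply: filter_forall => i; have [i0|i0] := eqVneq (dd 0 i) 0.
      by apply: nearW.
    near=> z => _; near: z.
    have pos : 0 < (2^-1 *: dd) 0 i * dd 0 i.
      by rewrite mxE -mulrA -expr2 mulr_gt0 ?invr_gt0 ?exprn_even_gt0.
    apply: (cvgr_gt _ _ _ pos).
    by apply: cvgM; [move/cvg_rowP : half; exact|move/cvg_rowP : d'd; exact].
  move=> H; near=> z => i.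
  have cz0 : 0 < `|c z| by near: z; exact: cinf.
  have [i0|i0] := eqVneq (dd 0 i) 0.
    by rewrite !mxE i0 mulr0 subr0 => ci; rewrite -expr2 exprn_even_gt0.
  move=> _; have : forall i, dd 0 i != 0 ->
      0 < (d' z - 2^-1 *: dd) 0 i * d' z 0 i by near: z.
  move=> /(_ i i0); rewrite /d' !mxE => pos.
  have -> : (c z 0 i - `|c z| / 2 * dd 0 i) * c z 0 i =
    `|c z| ^+ 2 * ((`|c z|^-1 * c z 0 i - 2^-1 * dd 0 i) * (`|c z|^-1 * c z 0 i)).
    by field; rewrite gt_eqF.
  by rewrite mulr_gt0// exprn_gt0.
have hn : \forall z \near G, `|d' z - 2^-1 *: dd| < 3 / 4.
  have := cvg_norm half; rewrite normrZ nd1 gtr0_norm ?invr_gt0// mulr1 => hh.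
  by apply: (cvgr_lt _ (hh _)); lra.
have [z [[[/= z1 z2] z3] z4]] := filter_ex (filterI (filterI (filterI confd hn) (cinf 4)) (filterT : G setT)).
have [ca cB /(_ _ (conformal_trans z1 ca))] := cP z.
rewrite mulmxBl -scalemxAl dB0 scaler0 subr0 => /(_ cB).
have cz0 : 0 < `|c z| by exact: lt_trans z3.
have -> : c z - (`|c z| / 2) *: dd = `|c z| *: (d' z - 2^-1 *: dd).
  by rewrite /d' scalerBr !scalerA divff ?scale1r ?gt_eqF.
rewrite normrZ normr_id => H.
have : `|c z| * `|d' z - 2^-1 *: dd| <= `|c z| * (3 / 4) by rewrite ler_pM2l// ltW.
lra.
Unshelve. all: by end_near. Qed.

End Ultrafilters.

(** * Taylor estimates uniform in the parameter *)

Section LineDerivative.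
Variables (R : realType) (n : nat).
Implicit Types (x d v : 'rV[R]_n).

Lemma dot_grad (phi : 'rV[R]_n -> R) x v : dot (grad phi x) v = 'd phi x v.
Proof.
rewrite {2}[v]row_sum_delta linear_sum dotE; apply: eq_bigr => i _.
by rewrite linearZ/= mxE mulrC.
Qed.

Lemma mulmx_hess (phi : 'rV[R]_n -> R) x v :
  v *m hess phi x = 'd (grad phi) x v.
Proof. by rewrite /hess /jacobian mul_rV_lin1. Qed.

Lemma is_diff_coord m (M : 'rV[R]_m) j :
  is_diff M (fun N : 'rV[R]_m => N 0 j : R) (fun N : 'rV[R]_m => N 0 j : R).
Proof.
have @f : {linear 'rV[R]_m -> R}.
  by exists (fun N : 'rV[R]_m => N 0 j); do 2![eexists]; do ?[constructor];
     rewrite ?mxE// => ? *; rewrite ?mxE//; move=> ?; rewrite !mxE.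
apply: DiffDef; first exact: differentiable_coord.
by rewrite (_ : (fun _ => _) = f) // diff_lin//; exact: coord_continuous.
Qed.

Lemma is_diff_row_coord m (f : 'rV[R]_n -> 'rV[R]_m) x j :
  differentiable f x ->
  is_diff x (fun y => f y 0 j) (fun v => ('d f x v) 0 j).
Proof.
move=> df; have dfx : is_diff x f ('d f x) by exact: DiffDef.
exact: (is_diff_comp dfx (is_diff_coord _ _)).
Qed.

Lemma is_derive_line (f : 'rV[R]_n -> R) x d (s : R) :
  differentiable f (x + s *: d) ->
  is_derive s 1 (fun s => f (x + s *: d)) ('d f (x + s *: d) d).
Proof.
move=> df.
have dl : is_diff s (cst x + *:%R^~ d) (0 + *:%R^~ d : R -> 'rV[R]_n).
  exact: is_diffD.
have dfx : is_diff ((cst x + *:%R^~ d : R -> 'rV[R]_n) s) f ('d f (x + s *: d)).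
  exact: DiffDef.
have := is_diff_comp dl dfx => H.
apply: DeriveDef; first by apply: diff_derivable; exact: ex_diff.
by rewrite deriveE ?diff_val/= ?add0r ?scale1r//; exact: ex_diff.
Qed.

Lemma mvt_line (f df : R -> R) :
  (forall s : R, 0 <= s <= 1 -> is_derive s 1 f (df s)) ->
  exists2 c, 0 <= c <= 1 & f 1 - f 0 = df c.
Proof.
move=> fdf.
have [|||c c01 ->] := @MVT_segment R f df 0 1.
- exact: ler01.
- by move=> s; rewrite in_itv/= => /andP[s0 s1]; apply: fdf; rewrite !ltW.
- apply: derivable_within_continuous => s; rewrite in_itv/= => s01.
  by have [] := fdf s s01.
by exists c; rewrite ?subr0 ?mulr1//; move: c01; rewrite in_itv.
Qed.

End LineDerivative.

Lemma mulmx_coord_le (R : realType) n m (d : 'rV[R]_n) (M : 'M[R]_(n, m)) j :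
  `|(d *m M) 0 j| <= n%:R * `|M| * enorm d.
Proof.
rewrite mxE; apply: (le_trans (ler_norm_sum _ _ _)).
apply: (@le_trans _ _ (\sum_(i < n) (`|M| * enorm d))).
  apply: ler_sum => i _; rewrite normrM mulrC.
  by rewrite ler_pM// ?coord_le_normr ?coord_le_enorm.
by rewrite sumr_const card_ord -mulrA mulr_natl.
Qed.

Lemma coord_sub_mulmx (R : realType) n m (d : 'rV[R]_n) (A B : 'M[R]_(n, m))
    (a b : 'rV[R]_m) j :
  a 0 j - b 0 j = (d *m A) 0 j -> (a - b - d *m B) 0 j = (d *m (A - B)) 0 j.
Proof. by move=> E; rewrite mulmxBr [RHS]mxE -E !mxE. Qed.

Lemma dot_sub_quad (R : realType) n (d a b : 'rV[R]_n) (A : 'M[R]_n) k :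
  dot (a - b - k *: d *m A) d = dot a d - dot b d - k * quad A d.
Proof. by rewrite !dotDl !dotNl -scalemxAl dotZl. Qed.

Section Taylor.
Variables (R : realType) (Omega : topologicalType) (n : nat).
Variables (phi : 'rV[R]_n * Omega -> R) (xb : 'rV[R]_n) (wb : Omega).
Local Notation slice w := (fun y => phi (y, w)).

(** Neighbourhoods of [(xb, wb)] contain boxes that are convex in the first
    variable, so a property that holds nearby also holds along the segment to
    [xb] with the parameter fixed. *)
Lemma near_segment (P : set ('rV[R]_n * Omega)) :
  (\forall z \near (xb, wb), P z) ->
  \forall z \near (xb, wb), forall s : R, 0 <= s <= 1 ->
    P (xb + s *: (z.1 - xb), z.2).
Proof.
move=> [[A B] /= [nA nB] AB]; have /nbhs_ballP[r /= r0 rA] := nA.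
exists (ball xb r, B) => /=; first by split => //; exact: nbhsx_ballx.
move=> [x w] /= [xr Bw] s /andP[s0 s1]; apply: AB; split => //=; apply: rA.
move: xr; rewrite -ball_normE /= => xr.
rewrite opprD addrA subrr add0r normrN normrZ ger0_norm//.
by apply: le_lt_trans xr; rewrite distrC ler_piMl.
Qed.

Hypothesis phi_diff : \forall z \near (xb, wb),
  differentiable (slice z.2) z.1 /\ differentiable (grad (slice z.2)) z.1.
Hypothesis hess_cont : {for (xb, wb), continuous (fun z => hess (slice z.2) z.1)}.
Local Notation H := (hess (slice wb) xb).

(** The expansion is around [xb] at the perturbed parameter, but with the Hessian
    at the reference parameter: this is where joint continuity of the Hessian
    is used. The mean value theorem is applied to each coordinate. *)
Lemma grad_taylor eps : 0 < eps -> \forall z \near (xb, wb),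
  enorm (grad (slice z.2) z.1 - grad (slice z.2) xb - (z.1 - xb) *m H)
    <= eps * enorm (z.1 - xb).
Proof.
move=> e0; pose c : R := (n.+1%:R * n.+1%:R)^-1 * eps.
have c0 : 0 < c by rewrite mulr_gt0// invr_gt0 mulr_gt0.
have hc : \forall z \near (xb, wb), `|hess (slice z.2) z.1 - H| <= c.
  by move/cvgrPdistC_le : hess_cont => /(_ _ c0).
apply: filterS (near_segment (filterI phi_diff hc)) => -[x w] /= seg.
set d := x - xb.
have coord j : `|(grad (slice w) x - grad (slice w) xb - d *m H) 0 j| <=
    n%:R * c * enorm d.
  have [s s01|k k01] := @mvt_line R
      (fun s => grad (slice w) (xb + s *: d) 0 j)
      (fun s => (d *m hess (slice w) (xb + s *: d)) 0 j).
    have [[_ dg] _] := seg s s01.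
    have dgj := is_diff_row_coord j dg.
    have := @is_derive_line R n (fun y => grad (slice w) y 0 j) xb d s.
    by rewrite diff_val mulmx_hess; apply; exact: ex_diff.
  have xd : xb + d = x by rewrite /d addrC subrK.
  rewrite scale1r scale0r addr0 xd => E; have [_ hk] := seg k k01.
  have -> : (grad (slice w) x - grad (slice w) xb - d *m H) 0 j =
      (d *m (hess (slice w) (xb + k *: d) - H)) 0 j.
    exact: coord_sub_mulmx.
  apply: (le_trans (mulmx_coord_le _ _ _)).
  by rewrite ler_wpM2r ?enorm_ge0// ler_wpM2l.
apply: (le_trans (enorm_le_sum _)).
apply: (le_trans (ler_sum _ (fun j _ => coord j))).
rewrite sumr_const card_ord -[leLHS]mulr_natl mulrA ler_wpM2r ?enorm_ge0//. rewrite mulrA.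
have -> : n%:R * n%:R * c =  n%:R * n%:R / (n.+1%:R * n.+1%:R) * eps.
  by rewrite /c mulrA.
rewrite ler_piMl ?(ltW e0)// ler_pdivrMr ?mul1r ?mulr_gt0//.
by rewrite ler_pM// ler_nat.
Qed.

(** Mean value theorem for the function minus its quadratic model along the
    segment; the derivative of the difference is controlled by the first-order
    expansion of the gradient. *)
Lemma second_order_taylor eps : 0 < eps -> \forall z \near (xb, wb),
  `|phi z - phi (xb, z.2) - dot (grad (slice z.2) xb) (z.1 - xb)
    - 2^-1 * quad H (z.1 - xb)| <= eps * enorm (z.1 - xb) ^+ 2.
Proof.
move=> e0.
apply: filterS (near_segment (filterI phi_diff (grad_taylor e0))) => -[x w] /= seg.
set d := x - xb.
have [s s01|k k01] := @mvt_line R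
    (fun s => phi (xb + s *: d, w) - 2^-1 * quad H d * s ^+ 2)
    (fun s => dot (grad (slice w) (xb + s *: d)) d - quad H d * s).
  have [[dp _] _] := seg s s01.
  have dl := @is_derive_line R n (slice w) xb d s dp.
  rewrite dot_grad; apply: is_derive_eq.
  by rewrite /GRing.scale/=; lra.
have xd : xb + d = x by rewrite /d addrC subrK.
rewrite scale1r scale0r addr0 xd => E; have [_ hk] := seg k k01.
have xkd : xb + k *: d - xb = k *: d by rewrite addrAC subrr add0r.
move: hk; rewrite xkd => hk.
have -> : phi (x, w) - phi (xb, w) - dot (grad (slice w) xb) d - 2^-1 * quad H d =
   dot (grad (slice w) (xb + k *: d) - grad (slice w) xb - k *: d *m H) d.
  have lin (u v a b c r : R) :
      u - 2^-1 * c * 1 ^+ 2 - (v - 2^-1 * c * 0 ^+ 2) = a - c * r ->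
      u - v - b - 2^-1 * c = a - b - r * c by move=> *; lra.
  by rewrite dot_sub_quad; exact: lin E.
apply: (le_trans (cauchy_schwarz_abs _ _)).
rewrite expr2 mulrA ler_wpM2r ?enorm_ge0//.
apply: (le_trans hk); rewrite ler_wpM2l ?(ltW e0)// enormZ.
by case/andP: k01 => k0 k1; rewrite ger0_norm// ler_piMl ?enorm_ge0.
Qed.

End Taylor.

(** * Metric regularity and normals *)

Section Auxiliary.
Variable R : realType.

Lemma near0_small (K c : R) : 0 < c -> \forall s \near 0^'+, K * s < c.
Proof.
move=> c0; have : K * s @[s --> 0^'+] --> K * 0.
  by apply: cvgM; [exact: cvg_cst|exact: cvg_at_right_filter].
by rewrite mulr0 => /cvgr_lt; apply.
Qed.

Lemma le_of_eps (a b K : R) :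
  (forall e, 0 < e -> e <= 1 -> a <= b + e * K) -> a <= b.
Proof.
move=> H; rewrite leNgt; apply/negP => ba.
have ab0 : 0 < a - b by rewrite subr_gt0.
have [e [[/= eK e1] e0]] := filter_ex (filterI (filterI (near0_small K ab0)
  (near0_small 1 ltr01)) (nbhs_right_gt (0 : R))).
have := H e e0; rewrite mul1r in e1; move=> /(_ (ltW e1)); rewrite mulrC; lra.
Qed.

Lemma near_enormP n (x : 'rV[R]_n) (A : set 'rV[R]_n) :
  nbhs x A <-> exists2 r : R, 0 < r & forall y, enorm (y - x) < r -> A y.
Proof.
split=> [/nbhs_ballP[r /= r0 rA]|[r r0 rA]].
  exists r => // y yr; apply: rA; rewrite -ball_normE/= distrC.
  exact: le_lt_trans (normr_le_enorm _) yr.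
have c0 : 0 < r / n.+1%:R by rewrite divr_gt0.
apply/nbhs_ballP; exists (r / n.+1%:R) => //= y; rewrite -ball_normE/= distrC => yr.
apply: rA; apply: (le_lt_trans (enorm_le_normr _)).
apply: (@le_lt_trans _ _ (n.+1%:R * `|y - x|)).
  by rewrite ler_wpM2r// ler_nat.
by rewrite mulrC -ltr_pdivlMr.
Qed.

Lemma enorm_mulmx_bound n m (A : 'M[R]_(n, m)) :
  exists2 C, 0 <= C & forall v, enorm (v *m A) <= C * enorm v.
Proof.
exists (m%:R * (n%:R * `|A|)); first by rewrite !mulr_ge0.
move=> v; apply: (le_trans (enorm_le_sum _)).
apply: (le_trans (ler_sum _ (fun j _ => mulmx_coord_le _ _ _))).
by rewrite sumr_const card_ord -[leLHS]mulr_natl !mulrA.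
Qed.

Lemma near_differential n m (q : 'rV[R]_n -> 'rV[R]_m) x e :
  differentiable q x -> 0 < e -> \forall y \near x,
    enorm (q y - q x - (y - x) *m jacobian q x) <= e * enorm (y - x).
Proof.
move=> dq e0; have c0 : 0 < m.+1%:R^-1 * e by rewrite mulr_gt0 ?invr_gt0.
have /diff_locallyP[_ /eqaddoP/(_ _ c0)/near_enormP[r r0 H]] := dq.
apply/near_enormP; exists r => // y yr.
have /= := H (y - x); rewrite subr0 => /(_ yr); rewrite /cst/=.
rewrite -[(_ - _) _]/(q (y - x + x) - (q x + 'd q x (y - x))) subrK.
rewrite opprD addrA -(mul_rV_lin1 ('d q x)) -/(jacobian q x) => {}H.
apply: (le_trans (enorm_le_normr _)).
apply: (le_trans (ler_wpM2l (ler0n _ _) H)).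
apply: (@le_trans _ _ (m%:R * (m.+1%:R^-1 * e * enorm (y - x)))).
  rewrite ler_wpM2l// ler_wpM2l ?(ltW c0)//; exact: normr_le_enorm.
rewrite !mulrA ler_wpM2r ?enorm_ge0// ler_piMl ?(ltW e0)//.
by rewrite ler_pdivrMr// mul1r ler_nat.
Qed.

End Auxiliary.

Section FrechetNormals.
Variables (R : realType).

(** Regular normals with the division by the distance cleared, so that the base
    point needs no special treatment. *)
Definition frechet_normal d (x : 'rV[R]_d) (C : set 'rV[R]_d) (xi : 'rV[R]_d) : Prop :=
  forall e, 0 < e -> exists2 r, 0 < r & forall y, C y -> enorm (y - x) < r ->
    dot xi (y - x) <= e * enorm (y - x).

Lemma regular_normalP d (x : 'rV[R]_d) C xi :
  regular_normal_cone x C xi -> frechet_normal x C xi.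
Proof.
move=> [Cx lim0] e e0.
have := le_lt_trans lim0 (_ : (0%:E < e%:E)%E); rewrite lte_fin => /(_ e0).
rewrite limf_esupE => /ereal_inf_lt[_ /= [V VF <-] Ve].
have /near_enormP[r r0 rV] : \forall y \near x, y != x -> C y -> V y by exact: VF.
exists r => // y Cy yr; have [->|yx] := eqVneq y x.
  by rewrite subrr dot0r enorm0 mulr0.
rewrite -ler_pdivrMr ?enorm_gt0 ?subr_eq0// -lee_fin ltW//.
apply: le_lt_trans Ve; apply: ereal_sup_ubound => /=.
by exists y => //; exact: rV.
Qed.

Lemma frechet_normal_dir d (x : 'rV[R]_d) C xi v :
  frechet_normal x C xi ->
  (\forall s \near 0^'+, C (x + s *: v)) -> dot xi v <= 0.
Proof.
move=> xiN Cv; apply: (@le_of_eps R _ _ (enorm v)) => e e0 _; rewrite add0r.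
have [r r0 H] := xiN e e0.
have [s [[/= Cs sr] s0]] := filter_ex (filterI (filterI Cv (near0_small (enorm v) r0))
  (nbhs_right_gt (0 : R))).
have := H _ Cs; rewrite addrAC subrr add0r enormZ gtr0_norm// dotZr => H1.
have : s * dot xi v <= s * (e * enorm v) by rewrite (mulrCA s); apply: H1; rewrite mulrC.
by rewrite ler_pM2l.
Qed.

End FrechetNormals.

Section MetricRegularityConsequences.
Variables (R : realType) (n m : nat).
Variables (q : 'rV[R]_n -> 'rV[R]_m) (P : set 'rV[R]_m) (x : 'rV[R]_n) (kappa : R).
Hypothesis kappa0 : 0 < kappa.
Hypothesis mr : metrically_regular (fun x => [set q x - y | y in P]) kappa x 0.
Hypothesis q_diff : differentiable q x.
Local Notation J := (jacobian q x).

(** Finite form of metric regularity: the infimal distance to the solution set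
    is realised up to the slack between the bound and [rho]. *)
Lemma metrically_regular_solve : exists2 r, 0 < r &
  forall x' y' p rho, enorm (x' - x) < r -> enorm y' < r -> P p ->
    kappa * enorm (y' - (q x' - p)) < rho ->
    exists2 z, P (q z - y') & enorm (x' - z) < rho.
Proof.
have [U [V [/near_enormP[r1 r10 rU] /near_enormP[r2 r20 rV] H]]] := mr.
exists (Num.min r1 r2) => [|x' y' p rho]; first by rewrite lt_min r10.
rewrite !lt_min => /andP[xr _] /andP[_ yr] Pp lt_rho.
have /= := H x' y' (rU _ xr); rewrite -{1}(subr0 y') in yr.
move=> /(_ (rV _ yr)) H'.
have : (edistance x' [set z | exists2 y, P y & (q z - y)%R = y'] < rho%:E)%E.
  apply: le_lt_trans H' _; apply: (@le_lt_trans _ _ (kappa * enorm (y' - (q x' - p)))%:E).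
    rewrite EFinM lee_pmul2l//; apply: ereal_inf_lbound => /=.
    by exists (q x' - p) => //; exists p.
  by rewrite lte_fin.
move=> /ereal_inf_lt[_ /= [z [y Py <-] <-]]; rewrite lte_fin => zr.
by exists z => //; rewrite opprB addrCA subrr addr0.
Qed.

(** Moving the right-hand side from a nearby point of [P] against the normal
    produces, by metric regularity, a feasible displacement of length at most
    [kappa] times the step, along which the normal inequality is tested.
    Stating it for normals at all points [p] near [q x] makes it applicable to
    approximate multipliers and spares any closedness of the normal cone. *)
Lemma normal_bound : exists2 r, 0 < r & forall p xi,
  P p -> enorm (p - q x) < r -> frechet_normal p P xi ->
  enorm xi <= kappa * enorm (xi *m J^T).
Proof.
have [r r0 solve] := metrically_regular_solve.
have [C C0 JC] := enorm_mulmx_bound J.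
exists r => // p xi Pp pr xiN.
have [->|xi0] := eqVneq xi 0; first by rewrite enorm0 mulr_ge0 ?enorm_ge0 ?(ltW kappa0).
have nxi := enorm_gt0 xi0.
set a := enorm (xi *m J^T); have a0 : 0 <= a := enorm_ge0 _.
pose K1 := kappa + 1; have K10 : 0 < K1 by rewrite addr_gt0.
pose K := a + enorm xi * K1 + ((C + 1) * K1 + 1).
apply: (@le_of_eps R _ _ K) => e e0 e1.
have /near_enormP[r1 r10 dq] := near_differential q_diff e0.
have [r2 r20 norm2] := xiN e e0.
have pr' : 0 < r - enorm (p - q x) by rewrite subr_gt0.
have [s [[[/= s1 s2] s3] s0]] := filter_ex (filterI (filterI (filterI
  (near0_small K1 r10) (near0_small ((C + 1) * K1 + 1) r20))
  (near0_small 1 pr')) (nbhs_right_gt (0 : R))).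
rewrite mul1r in s3.
(* The right-hand side moves from [q x - p], which [x] solves, in the unit
   direction [d] opposite to the normal. *)
pose d := - ((enorm xi)^-1 *: xi).
have nd : enorm d = 1.
  by rewrite enormN enormZ gtr0_norm ?invr_gt0// mulVf// gt_eqF.
have nsd : enorm (s *: d) = s by rewrite enormZ nd mulr1 gtr0_norm.
pose y' := q x - p + s *: d.
have [||||z] := solve x y' p ((kappa + e) * s).
- by rewrite subrr enorm0.
- apply: (le_lt_trans (enormD _ _)); rewrite nsd enormB; lra.
- by [].
- rewrite /y' addrAC subrr add0r nsd ltr_pM2r//; lra.
have -> : q z - y' = p + (q z - q x - s *: d).
  by rewrite /y' opprD opprB !addrA (addrC p) -!addrA; congr (_ + _); rewrite addrCA.
set h := z - x => Pz; rewrite enormB -/h => hlt.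
have hK : enorm h <= K1 * s.
  by apply: (le_trans (ltW hlt)); rewrite ler_wpM2r ?(ltW s0)// lerD2l.
have hr1 : enorm (z - x) < r1 by exact: le_lt_trans s1.
have rem := dq z hr1; rewrite -/h in rem; set w := q z - q x - h *m J in rem.
have qz : q z - q x = h *m J + w by rewrite [RHS]addrC /w subrK.
clearbody w h.
have big : enorm (q z - q x - s *: d) <= ((C + 1) * K1 + 1) * s.
  apply: (le_trans (enormD _ _)); rewrite enormN nsd mulrDl mul1r lerD2r qz.
  apply: (le_trans (enormD _ _)).
  apply: (@le_trans _ _ (C * enorm h + 1 * enorm h)); last first.
    by rewrite -mulrDl -mulrA ler_wpM2l// addr_ge0.
  by rewrite lerD// (le_trans rem)// ler_wpM2r// enorm_ge0.
have := norm2 _ Pz; rewrite addrAC subrr add0r => /(_ (le_lt_trans big s2)).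
have -> : dot xi (q z - q x - s *: d) = dot (xi *m J^T) h + dot xi w + s * enorm xi.
  rewrite qz !dotDr dotNr dotZr /d dotNr dotZr -enorm_sqr dot_mulmx trmxK.
  by rewrite mulrN opprK expr2 mulKf// gt_eqF.
move=> key.
have k1 : - (a * ((kappa + e) * s)) <= dot (xi *m J^T) h.
  rewrite lerNl -dotNl; apply: (le_trans (cauchy_schwarz _ _)); rewrite enormN.
  by rewrite ler_wpM2l// ltW.
have k2 : - (enorm xi * (e * (K1 * s))) <= dot xi w.
  rewrite lerNl -dotNl; apply: (le_trans (cauchy_schwarz _ _)); rewrite enormN.
  rewrite ler_wpM2l ?enorm_ge0//; apply: (le_trans rem).
  by rewrite ler_wpM2l// ltW.
have k3 : e * enorm (q z - q x - s *: d) <= e * (((C + 1) * K1 + 1) * s).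
  by rewrite ler_wpM2l// ltW.
have : s * enorm xi <= s * (kappa * a + e * K) by rewrite /K; lra.
by rewrite ler_pM2l.
Qed.

End MetricRegularityConsequences.

Lemma dot_sqrB (R : realType) d (a b : 'rV[R]_d) :
  dot (a - b) (a - b) = dot a a - 2 * dot a b + dot b b.
Proof. by rewrite dotDl !dotDr !dotNl !dotNr (dotC b a); lra. Qed.

Section Penalty.
Variables (R : realType) (n m : nat).
Variables (J : 'M[R]_(n, m)) (P : set 'rV[R]_m) (y : 'rV[R]_m) (xs : 'rV[R]_n).
Variables (r c : R).
Hypothesis P_closed : closed P.
Hypothesis Py : P y.
Hypothesis r0 : 0 < r.
Hypothesis c0 : 0 <= c.
Hypothesis penalty : forall v z, enorm z < r -> P (y + z) ->
  dot xs v <= c * enorm (v *m J - z).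

Let psi (k : R) (u : 'rV[R]_n * 'rV[R]_m) : R :=
  k * dot (u.1 *m J - u.2) (u.1 *m J - u.2) + dot u.1 u.1 - dot xs u.1.

Lemma psi_continuous k : continuous (psi k).
Proof.
move=> u; apply: cvgB; last first.
  by apply: cvg_dot; [exact: cvg_cst|exact: cvg_fst].
apply: cvgD; last by apply: cvg_dot; exact: cvg_fst.
apply: cvgM; first exact: cvg_cst.
have H : (fun u : 'rV[R]_n * 'rV[R]_m => u.1 *m J - u.2) v @[v --> u] --> u.1 *m J - u.2.
  by apply: cvgB; [apply: cvg_mulmx; exact: cvg_fst|exact: cvg_snd].
exact: (cvg_dot H H).
Qed.

Lemma psi_minimizer k : exists v z,
  [/\ enorm v <= 1, enorm z <= r / 2, P (y + z) &
    forall v' z', enorm v' <= 1 -> enorm z' <= r / 2 -> P (y + z') ->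
      psi k (v, z) <= psi k (v', z')].
Proof.
pose A : set 'rV[R]_n := [set v | enorm v <= 1].
pose B : set 'rV[R]_m := [set z | enorm z <= r / 2 /\ P (y + z)].
have bounded d (D : set 'rV[R]_d) M : (forall v, D v -> enorm v <= M) -> bounded_set D.
  move=> DM; exists M; split; first exact: num_real.
  move=> M' MM' v Dv; apply: (le_trans (normr_le_enorm _)).
  exact: le_trans (DM v Dv) (ltW MM').
have cl d M : closed [set v : 'rV[R]_d | enorm v <= M].
  have /continuous_closedP H : continuous (@enorm R d).
    by move=> v; apply: (@cvg_enorm _ _ (nbhs v) _ _ id v); exact: cvg_id.
  exact/(H [set t | t <= M])/closed_le.
have cA : compact A.
  by apply: bounded_closed_compact; [apply: (@bounded _ _ 1)|exact: cl].
have cB : compact B.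
  apply: bounded_closed_compact; first by apply: (@bounded _ _ (r / 2)) => v [].
  apply: closedI; first exact: cl.
  have /continuous_closedP : continuous (fun z : 'rV[R]_m => y + z); last exact.
  by move=> z; exact: (cvgD (cvg_cst y) (@cvg_id _ (nbhs z))).
have [||[v z]] := @compact_EVT_min _ R (psi k) (A `*` B) _ (compact_setX cA cB).
- exists (0, 0); split => /=; rewrite /A /B/= enorm0 ?ler01//.
  by rewrite addr0; split=> //; rewrite divr_ge0// ltW.
- exact/continuous_subspaceT/psi_continuous.
rewrite inE => -[/= Av [zr Bz]] H; exists v, z; split => // v' z' v'1 z'r Pz'.
by apply: H; rewrite inE.
Qed.

(** Minimise [k |v J - z|^2 + |v|^2 - <xs, v>] over [y + z] in [P]. The hypothesis
    [penalty] keeps [k |v J - z|] below [c], so for large [k] the minimiser is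
    interior and close to the origin. Stationarity in [z] makes
    [xi = 2 k (v J - z)] a regular normal at [y + z], and stationarity in [v]
    gives the adjoint equation up to the error [- 2 v]. *)
Lemma penalty_normal delta : 0 < delta -> exists p xi,
  [/\ P p, enorm (p - y) < delta, frechet_normal p P xi &
      enorm (xi *m J^T - xs) < delta].
Proof.
move=> d0; have [C C0 JC] := enorm_mulmx_bound J.
have [s [[[[/= s1 s2] s3] s4] s0]] := filter_ex (filterI (filterI (filterI (filterI
  (near0_small 1 (ltr01 : 0 < (1:R))) (near0_small 2 d0)) (near0_small (C + 1) d0))
  (near0_small (C + 1) (divr_gt0 r0 (ltr0n R 2)))) (nbhs_right_gt (0 : R))).
rewrite mul1r in s1.
(* [|v J - z| <= c / k] and [|v|^2 <= c^2 / k] are below [s] and [s^2]. *)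
pose k := (c + 1) ^+ 2 / s ^+ 2.
have c10 : 0 < c + 1 by rewrite ltr_wpDl.
have k0 : 0 < k by rewrite divr_gt0// exprn_gt0.
have [v [z [v1 zr Pz Hmin]]] := psi_minimizer k.
have [w wE] : exists w, v *m J - z = w by eexists.
have psi0 : k * enorm w ^+ 2 + enorm v ^+ 2 <= c * enorm w.
  have := Hmin 0 0; rewrite !enorm0 ler01 addr0 divr_ge0 ?(ltW r0)//.
  move=> /(_ isT isT Py); rewrite /psi/= mul0mx subr0 !dot0r wE !enorm_sqr => h.
  have pen := @penalty v z _ Pz; rewrite wE in pen.
  have {}pen : dot xs v <= c * enorm w.
    by apply: pen; apply: (le_lt_trans zr); rewrite ltr_pdivrMr// ltr_pMr// ltr1n.
  lra.
have w0 : 0 <= enorm w := enorm_ge0 _.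
have v0 : 0 <= enorm v := enorm_ge0 _.
have kw : k * enorm w <= c.
  have [e0|en0] := eqVneq (enorm w) 0; first by rewrite e0 mulr0.
  have : k * enorm w * enorm w <= c * enorm w by have := sqr_ge0 (enorm v); lra.
  by rewrite ler_pM2r// lt_neqAle eq_sym en0.
have ks : k * s ^+ 2 = (c + 1) ^+ 2 by rewrite /k divfK// gt_eqF// exprn_gt0.
have ws : enorm w < s.
  rewrite -(ltr_pM2l k0); apply: (le_lt_trans kw).
  have : s * c < s * (k * s).
    rewrite [ltRHS](_ : _ = k * s ^+ 2); last by ring.
    rewrite ks; apply: (@le_lt_trans _ _ (1 * c)).
      by rewrite ler_wpM2r// ltW.
    rewrite expr2; nra.
  by rewrite ltr_pM2l.
have vs : enorm v < s.
  rewrite -ltr_sqr ?nnegrE ?(ltW s0)// -(ltr_pM2l k0) ks.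
  have : k * enorm v ^+ 2 <= c * (k * enorm w).
    have : k * enorm v ^+ 2 <= k * (c * enorm w).
      rewrite ler_pM2l//; have : 0 <= k * enorm w ^+ 2; last by lra.
      by rewrite mulr_ge0 ?sqr_ge0// ltW.
    lra.
  have : c * (k * enorm w) <= c * c by rewrite ler_wpM2l.
  have := c0; nra.
have zs : enorm z <= (C + 1) * s.
  have -> : z = v *m J - w by rewrite -wE opprB addrC subrK.
  apply: (le_trans (enormD _ _)); rewrite enormN mulrDl mul1r lerD ?(ltW ws)//.
  by apply: (le_trans (JC _)); rewrite ler_wpM2l// ltW.
pose xi := (2 * k) *: w.
exists (y + z), xi; split => //.
- by rewrite addrAC subrr add0r (le_lt_trans zs).
- have zr2 : 0 < r / 2 - enorm z by rewrite subr_gt0 (le_lt_trans zs).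
  move=> e e0; exists (Num.min (e / k) (r / 2 - enorm z)).
    by rewrite lt_min divr_gt0.
  move=> p Pp; rewrite lt_min => /andP[h1 h2].
  set h := p - (y + z).
  have zh : p = y + (z + h) by rewrite /h addrA [RHS]addrC subrK.
  have := Hmin v (z + h) v1 _ _; rewrite -zh => /(_ _ Pp) H.
  have {}H : psi k (v, z) <= psi k (v, z + h).
    by apply: H; apply: (le_trans (enormD _ _)); rewrite -/h in h2; lra.
  move: H; rewrite /psi/= opprD addrA wE.
  rewrite (dot_sqrB w h) dotZl.
  have : dot h h <= e / k * enorm h.
    by rewrite -enorm_sqr expr2 ler_wpM2r ?enorm_ge0// ltW.
  rewrite mulrAC ler_pdivlMr//; lra.
- have -> : xi *m J^T - xs = - 2 *: v; last first.
    rewrite enormZ normrN ger0_norm//; apply: le_lt_trans s2.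
    by rewrite ler_wpM2l// ltW.
  apply/eqP; rewrite -subr_eq0; apply/eqP.
  (* [g] is the gradient of the objective in [v]; a step against it
     would decrease the objective. *)
  set g := _ - _; apply: enorm_eq0.
  have [//|gn0] := eqVneq (enorm g) 0; exfalso.
  have g0 : 0 < enorm g by rewrite lt_neqAle eq_sym gn0 enorm_ge0.
  have g20 : 0 < enorm g ^+ 2 by rewrite exprn_gt0.
  pose Q := k * enorm (g *m J) ^+ 2 + enorm g ^+ 2.
  have v10 : 0 < 1 - enorm v by rewrite subr_gt0 (lt_trans vs).
  have [t [[/= tQ t1] t0]] := filter_ex (filterI (filterI (near0_small Q g20)
    (near0_small (enorm g) v10)) (nbhs_right_gt (0 : R))).
  have := Hmin (v - t *: g) z _ zr Pz => H.
  have {}H : psi k (v, z) <= psi k (v - t *: g, z).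
    apply: H; apply: (le_trans (enormD _ _)).
    by rewrite enormN enormZ gtr0_norm//; lra.
  have gE : enorm g ^+ 2 = 2 * k * dot w (g *m J) - dot xs g + 2 * dot v g.
    rewrite enorm_sqr {1}/g !dotDl !dotNl !dotZl /xi dot_mulmx trmxK dotZl.
    by rewrite mulNr opprK.
  have Jt : (v - t *: g) *m J - z = w - t *: (g *m J).
    by rewrite mulmxBl -scalemxAl addrAC wE.
  move: H; rewrite /psi/= Jt wE.
  rewrite (dot_sqrB w) (dot_sqrB v) dotDr dotNr !dotZl !dotZr -!enorm_sqr => H.
  have : t * enorm g ^+ 2 <= t * (Q * t) by rewrite gE /Q; lra.
  rewrite ler_pM2l//; lra.
Qed.

End Penalty.

Section NormalsOfPreimage.
Variables (R : realType) (n m : nat).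
Variables (q : 'rV[R]_n -> 'rV[R]_m) (P : set 'rV[R]_m) (x : 'rV[R]_n) (kappa : R).
Hypothesis kappa0 : 0 < kappa.
Hypothesis mr : metrically_regular (fun x => [set q x - y | y in P]) kappa x 0.
Hypothesis q_diff : differentiable q x.
Local Notation J := (jacobian q x).

(** A regular normal to the preimage is dominated by the distance to the preimage,
    which metric regularity bounds by the residual in the image space. Along a
    ray [x + t v] this residual is [t |v J - z| + o(t)] for every direction [z]
    that stays in [P]. *)
Lemma preimage_normal_penalty xs v z :
  frechet_normal x [set x' | P (q x')] xs ->
  (\forall t \near 0^'+, P (q x + t *: z)) ->
  dot xs v <= kappa * enorm xs * enorm (v *m J - z).
Proof.
move=> xsN zP; have [r r0 solve] := metrically_regular_solve kappa0 mr.
set s0 := enorm (v *m J - z).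
have s00 : 0 <= s0 := enorm_ge0 _.
have v0 : 0 <= enorm v := enorm_ge0 _.
have x0 : 0 <= enorm xs := enorm_ge0 _.
pose K := enorm xs * (kappa * enorm v + 1) +
  (enorm v + kappa * s0 + kappa * enorm v + 1).
apply: (@le_of_eps R _ _ K) => e e0 e1.
pose E := kappa * (s0 + e * enorm v) + e.
have E0 : 0 <= E.
  by rewrite addr_ge0 ?(ltW e0)// mulr_ge0 ?(ltW kappa0)// addr_ge0// mulr_ge0// ltW.
have /near_enormP[r1 r10 dq] := near_differential q_diff e0.
have [r2 r20 norm2] := xsN e e0.
have [t [[[[/= tP t1] t2] t3] t0]] := filter_ex (filterI (filterI (filterI (filterI zP
  (near0_small (enorm v) r10)) (near0_small (enorm v) r0))
  (near0_small (enorm v + E) r20)) (nbhs_right_gt (0 : R))).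
have tv : enorm (x + t *: v - x) = t * enorm v.
  by rewrite addrAC subrr add0r enormZ gtr0_norm.
have rem := dq (x + t *: v); rewrite tv mulrC in rem; have {}rem := rem t1.
rewrite (addrAC x) subrr add0r in rem.
have dist : enorm (0 - (q (x + t *: v) - (q x + t *: z))) <= t * (s0 + e * enorm v).
  rewrite sub0r enormN.
  have -> : q (x + t *: v) - (q x + t *: z) =
     (q (x + t *: v) - q x - (t *: v) *m J) + t *: (v *m J - z).
    rewrite -scalemxAl scalerBr opprD !addrA; congr (_ - _).
    by rewrite subrK.
  apply: (le_trans (enormD _ _)); rewrite enormZ gtr0_norm// -/s0.
  apply: (@le_trans _ _ (e * (enorm v * t) + t * s0)); first by rewrite lerD2r.
  by rewrite mulrDr [leLHS]addrC lerD2l (mulrC _ t) mulrCA.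
have [|||z' Pz' zz'] := solve (x + t *: v) 0 (q x + t *: z) (t * E) _ _ tP.
- by rewrite tv mulrC.
- by rewrite enorm0.
- apply: (@le_lt_trans _ _ (kappa * (t * (s0 + e * enorm v)))).
    by rewrite ler_wpM2l// ltW.
  have -> : t * E = kappa * (t * (s0 + e * enorm v)) + t * e by rewrite /E; ring.
  by rewrite ltrDl mulr_gt0.
rewrite subr0 in Pz'.
have zx : enorm (z' - x) <= t * (enorm v + E).
  have -> : z' - x = (z' - (x + t *: v)) + t *: v by rewrite opprD addrA subrK.
  apply: (le_trans (enormD _ _)); rewrite enormB enormZ gtr0_norm//.
  by rewrite mulrDr addrC lerD2l ltW.
have n1 : dot xs (z' - x) <= e * (t * (enorm v + E)).
  apply: (le_trans (norm2 z' Pz' _)); first by apply: (le_lt_trans zx); rewrite mulrC.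
  by rewrite ler_wpM2l// ltW.
have n2 : dot xs (x + t *: v - z') <= enorm xs * (t * E).
  by apply: (le_trans (cauchy_schwarz _ _)); rewrite ler_wpM2l// ltW.
have n3 : dot xs (x + t *: v - z') + dot xs (z' - x) = t * dot xs v.
  by rewrite -dotDr addrA subrK addrAC subrr add0r dotZr.
have : t * dot xs v <= t * (kappa * enorm xs * s0 + e * K).
  have h3 : e * E <= e * (kappa * s0 + kappa * enorm v + 1).
    rewrite ler_pM2l// /E.
    have : e * (kappa * enorm v) <= kappa * enorm v by rewrite ler_piMl// mulr_ge0// ltW.
    lra.
  have h4 : t * (e * E) <= t * (e * (kappa * s0 + kappa * enorm v + 1)) by rewrite ler_pM2l.
  have := lerD n2 n1; rewrite n3 => n4.
  by rewrite /K; rewrite /E in h4 n4; lra.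
by rewrite ler_pM2l.
Qed.

(** A fuzzy chain rule: regular normals to the preimage are approximated by images
    of regular normals to [P] at nearby points. Local star-shapedness turns all
    small displacements inside [P] into feasible directions. *)
Lemma preimage_approximate_normal xs r delta :
  closed P -> P (q x) -> 0 < r ->
  (forall z, enorm z < r -> P (q x + z) ->
     forall t, 0 <= t <= 1 -> P (q x + t *: z)) ->
  frechet_normal x [set x' | P (q x')] xs -> 0 < delta ->
  exists p xi, [/\ P p, enorm (p - q x) < delta, frechet_normal p P xi &
      enorm (xi *m J^T - xs) < delta].
Proof.
move=> Pcl Pqx r0 star xsN d0.
apply: (@penalty_normal _ _ _ J P (q x) xs r (kappa * enorm xs)) => //.
  by rewrite mulr_ge0 ?enorm_ge0// ltW.
move=> v z zr Pz; apply: preimage_normal_penalty => //.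
near=> t; apply: star => //; apply/andP; split; near: t.
  exact: nbhs_right_ge.
exact: nbhs_right_le.
Unshelve. all: by end_near. Qed.

End NormalsOfPreimage.

(** * Geometry of the complementarity constraint set *)

Section ConstraintSet.
Variables (R : realType) (mI mE mC : nat).
Local Notation N := (mI + (mE + (mC + mC)))%N.
Local Notation Y := 'rV[R]_N.
Local Notation P := (@Pset R mI mE mC).

Definition idx_g (i : 'I_mI) : 'I_N := lshift (mE + (mC + mC)) i.
Definition idx_h (i : 'I_mE) : 'I_N := rshift mI (lshift (mC + mC) i).
Definition idx_G (i : 'I_mC) : 'I_N := rshift mI (rshift mE (lshift mC i)).
Definition idx_H (i : 'I_mC) : 'I_N := rshift mI (rshift mE (rshift mC i)).

Lemma idx_ind (A : 'I_N -> Prop) :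
  (forall i, A (idx_g i)) -> (forall i, A (idx_h i)) ->
  (forall i, A (idx_G i)) -> (forall i, A (idx_H i)) -> forall j, A j.
Proof.
move=> Ag Ah AG AH j.
case: (split_ordP j) => k ->; first exact: Ag.
case: (split_ordP k) => {}k ->; first exact: Ah.
by case: (split_ordP k) => {}k ->; [exact: AG|exact: AH].
Qed.

Lemma idx_GH_neq i i' : idx_G i != idx_H i'.
Proof. by rewrite /idx_G /idx_H !(inj_eq (@rshift_inj _ _)) eq_lrshift. Qed.

Lemma QEC_row2 (a b : R) : @QEC R (row2 a b) <-> [/\ a <= 0, b <= 0 & a * b = 0].
Proof. by rewrite /QEC/= !mxE. Qed.

Lemma PsetP (y : Y) : P y <->
  [/\ forall i, y 0 (idx_g i) <= 0, forall i, y 0 (idx_h i) = 0 &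
      forall i, [/\ y 0 (idx_G i) <= 0, y 0 (idx_H i) <= 0 &
                    y 0 (idx_G i) * y 0 (idx_H i) = 0]].
Proof.
split=> [[a [b [c [d [-> a0 -> cd]]]]]|[g0 h0 GH0]].
  split=> i; rewrite /idx_g /idx_h /idx_G /idx_H ?row_mxEr ?row_mxEl ?mxE//.
  exact/QEC_row2.
exists (lsubmx y), (lsubmx (rsubmx y)), (lsubmx (rsubmx (rsubmx y))),
  (rsubmx (rsubmx (rsubmx y))); split.
- by rewrite !hsubmxK.
- by move=> i; rewrite mxE; exact: g0.
- by apply/rowP => i; rewrite !mxE; exact: h0.
- by move=> i; apply/QEC_row2; rewrite !mxE; exact: GH0.
Qed.

Lemma Pset_closed : closed P.
Proof.
move=> y clPy.
have PF : ProperFilter (within P (nbhs y)) by exact: within_nbhs_proper.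
have lim j : (z 0 j @[z --> within P (nbhs y)] --> y 0 j).
  have H := @coord_continuous R 1 N 0 j y.
  exact: (@cvg_within_filter _ _ _ (nbhs y) _ (nbhs (y 0 j)) P H).
have PW : \forall z \near within P (nbhs y), P z by exact: withinT.
apply/PsetP; split=> i.
- by apply: (cvg_le0 (lim _)); apply: filterS PW => z /PsetP[].
- by apply: (cvg_eq0 (lim _)); apply: filterS PW => z /PsetP[].
- split.
  + by apply: (cvg_le0 (lim _)); apply: filterS PW => z /PsetP[_ _ /(_ i)[]].
  + by apply: (cvg_le0 (lim _)); apply: filterS PW => z /PsetP[_ _ /(_ i)[]].
  + apply: (cvg_eq0 (cvgM (lim _) (lim _))).
    by apply: filterS PW => z /PsetP[_ _ /(_ i)[]].
Qed.

Lemma nonzero_coord_gap (y : Y) :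
  exists2 r, 0 < r & forall j, y 0 j != 0 -> r <= `|y 0 j|.
Proof.
have : \forall e \near (0:R)^'+, forall j, y 0 j != 0 -> e <= `|y 0 j|.
  apply: filter_forall => j; have [->|y0] := eqVneq (y 0 j) 0.
    by apply: nearW => e /=.
  near=> e => _; near: e; apply: nbhs_right_le.
  by rewrite normr_gt0.
move=> H; have [e [He e0]] := filter_ex (filterI H (nbhs_right_gt (0 : R))).
by exists e.
Unshelve. all: by end_near. Qed.

(** [P] is a union of polyhedral cones, hence locally conic: below the gap
    of the nonzero coordinates, no coordinate changes sign. *)
Lemma Pset_star (y : Y) : P y -> exists2 r, 0 < r & forall z,
  enorm z < r -> P (y + z) -> forall t, 0 <= t <= 1 -> P (y + t *: z).
Proof.
move=> /PsetP[g0 h0 GH0]; have [r r0 gap] := nonzero_coord_gap y.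
exists r => // z zr /PsetP[gz hz GHz] t /andP[t0 t1].
have conv (a b : R) : a <= 0 -> a + b <= 0 -> a + t * b <= 0.
  move=> a0 ab; have -> : a + t * b = (1 - t) * a + t * (a + b) by ring.
  by rewrite -[0]addr0 lerD// mulr_ge0_le0// subr_ge0.
have nz j : y 0 j != 0 -> y 0 j + z 0 j != 0.
  move=> yj; apply/eqP => yz; have := le_lt_trans (coord_le_enorm z j) zr.
  have -> : z 0 j = - y 0 j by lra.
  by rewrite normrN ltNge gap.
have E j : (y + t *: z) 0 j = y 0 j + t * z 0 j by rewrite !mxE.
have E1 j : (y + z) 0 j = y 0 j + z 0 j by rewrite !mxE.
apply/PsetP; split=> i; rewrite !E.
- by apply: conv (g0 i) _; rewrite -E1.
- by have := hz i; rewrite E1 h0 !add0r => ->; rewrite mulr0.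
have [G0 H0 GH] := GH0 i; have [] := GHz i; rewrite !E1 => Gz Hz GHzi.
split; [exact: conv|exact: conv|].
have [yG|yG] := eqVneq (y 0 (idx_G i)) 0; have [yH|yH] := eqVneq (y 0 (idx_H i)) 0.
- move: GHzi; rewrite yG yH !add0r => zz.
  by rewrite mulrACA zz mulr0.
- move/eqP: GHzi; rewrite mulf_eq0 (negbTE (nz _ yH)) orbF yG add0r => /eqP ->.
  by rewrite mulr0 addr0 mul0r.
- move/eqP: GHzi; rewrite mulf_eq0 (negbTE (nz _ yG)) yH/= add0r => /eqP ->.
  by rewrite mulr0 addr0 mulr0.
- by move/eqP: GH; rewrite mulf_eq0 (negbTE yG) (negbTE yH).
Qed.

(** The limiting normal cone of the complementarity angle at its apex. *)
Definition EC_normal (a b : R) : Prop := (0 < a /\ 0 < b) \/ a * b = 0.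

Definition normal_signs (y eta : Y) : Prop :=
  [/\ forall j, y 0 j != 0 -> eta 0 j = 0,
      forall i, 0 <= eta 0 (idx_g i) &
      forall i, EC_normal (eta 0 (idx_G i)) (eta 0 (idx_H i))].

Lemma near0_coord (y : Y) j (a : R) : y 0 j < 0 ->
  \forall s \near 0^'+, y 0 j + s * a < 0.
Proof.
move=> y0; have := near0_small a (_ : 0 < - y 0 j); rewrite oppr_gt0 => /(_ y0).
by apply: filterS => s; rewrite mulrC; lra.
Qed.

(** Test the normal inequality along coordinate directions: an inequality
    coordinate, or a complementarity coordinate whose partner is zero, may be
    decreased, and a negative coordinate may also be increased. *)
Lemma frechet_normal_signs (y eta : Y) :
  P y -> frechet_normal y P eta -> normal_signs y eta.
Proof.
move=> Py etaN; have [g0 h0 GH0] := (PsetP y).1 Py.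
have dirE j (a s : R) k :
    (y + s *: (a *: delta_mx 0 j)) 0 k = y 0 k + s * a * (k == j)%:R.
  by rewrite !mxE eqxx/= mulrA.
have dirP j (a : R) : (\forall s \near 0^'+, P (y + s *: (a *: delta_mx 0 j))) ->
    a * eta 0 j <= 0.
  by move=> /(frechet_normal_dir etaN); rewrite dotZr dot_delta.
have line j (a : R) : a <= 0 \/ y 0 j < 0 -> (forall i, idx_h i != j) ->
    (forall i, idx_G i = j -> y 0 (idx_H i) = 0) ->
    (forall i, idx_H i = j -> y 0 (idx_G i) = 0) -> a * eta 0 j <= 0.
  move=> aj jh jG jH; apply: dirP.
  have yk0 : \forall s \near 0^'+, y 0 j <= 0 -> y 0 j + s * a <= 0.
    case: aj => [a0|yj]; last by apply: filterS (near0_coord a yj) => s /ltW.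
    apply: filterS (nbhs_right_ge (0 : R)) => s s0 yj.
    by rewrite -[leRHS]addr0 lerD// mulr_ge0_le0.
  apply: filterS yk0 => s sj.
  have le0 k : y 0 k <= 0 -> y 0 k + s * a * (k == j)%:R <= 0.
    by have [->|_] := eqVneq k j; rewrite ?mulr1// mulr0 addr0.
  apply/PsetP; split=> i; rewrite !dirE.
  - exact: le0.
  - by rewrite (negbTE (jh i)) mulr0 addr0.
  - have [G0 H0 GH] := GH0 i; split; [exact: le0|exact: le0|].
    have [Gj|Gj] := eqVneq (idx_G i) j.
      by rewrite (jG i Gj) -Gj eq_sym (negbTE (idx_GH_neq _ _)) mulr0 addr0 mulr0.
    have [Hj|Hj] := eqVneq (idx_H i) j; last by rewrite !mulr0 !addr0.
    by rewrite (jH i Hj) mulr0 addr0 mul0r.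
have le0 j : y 0 j <= 0.
  by move: j; apply: idx_ind => i; rewrite ?h0//; have [] := GH0 i.
have partnerH i : y 0 (idx_G i) < 0 -> y 0 (idx_H i) = 0.
  move=> yG; have [_ _ /eqP] := GH0 i.
  by rewrite mulf_eq0 (lt_eqF yG) => /eqP.
have partnerG i : y 0 (idx_H i) < 0 -> y 0 (idx_G i) = 0.
  move=> yH; have [_ _ /eqP] := GH0 i.
  by rewrite mulf_eq0 (lt_eqF yH) orbF => /eqP.
have inactive j : y 0 j != 0 -> eta 0 j = 0.
  move=> yj; have {}yj : y 0 j < 0 by rewrite lt_neqAle yj le0.
  have cond a : a * eta 0 j <= 0.
    apply: line; [by right| | |] => i.
    - by apply: contraTneq yj => <-; rewrite h0 ltxx.
    - by move=> ij; apply: partnerH; rewrite ij.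
    - by move=> ij; apply: partnerG; rewrite ij.
  by have := cond 1; have := cond (-1); rewrite mul1r mulN1r; lra.
have N1le : (-1 : R) <= 0 by rewrite oppr_le0.
split=> // i.
  rewrite -oppr_le0 -mulN1r; apply: line => [|k|k|k]; first by left.
  - by rewrite eq_sym eq_lrshift.
  - by move/eqP; rewrite eq_sym eq_lrshift.
  - by move/eqP; rewrite eq_sym eq_lrshift.
have [yG|yG] := eqVneq (y 0 (idx_G i)) 0; last first.
  by right; rewrite (inactive _ yG) mul0r.
have [yH|yH] := eqVneq (y 0 (idx_H i)) 0; last first.
  by right; rewrite (inactive _ yH) mulr0.
have etaG : 0 <= eta 0 (idx_G i).
  rewrite -oppr_le0 -mulN1r; apply: line => [|k|k|k]; first by left.
  - by rewrite /idx_h /idx_G (inj_eq (@rshift_inj _ _)) eq_lrshift.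
  - by move/rshift_inj/rshift_inj/lshift_inj => ->.
  - by move/esym/eqP; rewrite (negbTE (idx_GH_neq _ _)).
have etaH : 0 <= eta 0 (idx_H i).
  rewrite -oppr_le0 -mulN1r; apply: line => [|k|k|k]; first by left.
  - by rewrite /idx_h /idx_H (inj_eq (@rshift_inj _ _)) eq_lrshift.
  - by move/eqP; rewrite (negbTE (idx_GH_neq _ _)).
  - by move/rshift_inj/rshift_inj/rshift_inj => ->.
move: etaG etaH; rewrite !le_eqVlt => /orP[/eqP<- _|G0 /orP[/eqP<-|H0]].
- by right; rewrite mul0r.
- by right; rewrite mulr0.
- by left.
Qed.

End ConstraintSet.

(** * Gradients and Hessians of linear combinations and coordinates *)

Section DifferentialCalculus.
Variables (R : realType) (n : nat).
Local Notation X := 'rV[R]_n.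

Lemma near_eq_is_diff (V : normedModType R) (f g : X -> V) (x : X) :
  (\forall y \near x, f y = g y) -> differentiable f x -> is_diff x g ('d f x).
Proof.
move=> fg df; have [dfc dfo] := (diff_locallyP _ _).1 df.
have fgx : f x = g x by exact: nbhs_singleton fg.
have dgo : g \o shift x = cst (g x) + 'd f x +o_ (0 : X) id.
  apply/eqaddoP => e e0; move/eqaddoP: dfo => /(_ e e0) dfo.
  have [r r0 rfg] := (near_enormP _ _).1 fg.
  have : \forall h \near (0 : X), f (h + x) = g (h + x).
    by apply/near_enormP; exists r => // h; rewrite subr0 => hr; apply: rfg; rewrite addrK.
  move=> near0; apply: filterS (filterI dfo near0) => h /= [H1 H2].
  by change (is_true (`|g (h + x) - (g x + 'd f x h)| <= e * `|h|)); rewrite -H2 -fgx.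
have gd := diff_unique dfc dgo.
have dg : differentiable g x.
  apply/diff_locallyP; rewrite gd; split; [exact: dfc|exact: dgo].
exact: DiffDef dg gd.
Qed.

Lemma is_diff_sum (V : normedModType R) (I : Type) (r : seq I) (f df : I -> X -> V) x :
  (forall i, is_diff x (f i) (df i)) ->
  is_diff x (fun y => \sum_(i <- r) f i y) (fun v => \sum_(i <- r) df i v).
Proof.
move=> H; elim: r => [|i r IH].
  have -> : (fun y => \sum_(i <- [::]) f i y) = cst 0 by apply/funext => y; rewrite big_nil.
  have -> : (fun y => \sum_(i <- [::]) df i y) = 0 by apply/funext => y; rewrite big_nil.
  exact: is_diff_cst.
have -> : (fun y => \sum_(j <- i :: r) f j y) = f i + (fun y => \sum_(j <- r) f j y).
  by apply/funext => y; rewrite big_cons.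
have -> : (fun y => \sum_(j <- i :: r) df j y) = df i + (fun y => \sum_(j <- r) df j y).
  by apply/funext => y; rewrite big_cons.
exact: is_diffD.
Qed.

Lemma is_diff_lincomb (V : normedModType R) m (a : R) (eta : 'I_m -> R)
    (f : X -> V) (g : 'I_m -> X -> V) x :
  differentiable f x -> (forall j, differentiable (g j) x) ->
  is_diff x (fun y => a *: f y + \sum_(j < m) eta j *: g j y)
    (fun v => a *: 'd f x v + \sum_(j < m) eta j *: 'd (g j) x v).
Proof.
move=> df dg.
have H1 : is_diff x (a *: f) (a *: ('d f x : X -> V)) by apply: is_diffZ; exact: DiffDef.
have H2 : is_diff x (fun y => \sum_(j < m) eta j *: g j y)
    (fun v => \sum_(j < m) eta j *: 'd (g j) x v).
  apply: is_diff_sum => j.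
  have : is_diff x (eta j *: g j) (eta j *: ('d (g j) x : X -> V)).
    by apply: is_diffZ; exact: DiffDef.
  exact.
exact: (is_diffD H1 H2).
Qed.

Lemma grad_lincomb m (a : R) (eta : 'rV[R]_m) (f : X -> R) (g : 'I_m -> X -> R) (x : X) :
  differentiable f x -> (forall j, differentiable (g j) x) ->
  grad (fun y => a * f y + \sum_(j < m) eta 0 j * g j y) x =
    a *: grad f x + \sum_(j < m) eta 0 j *: grad (g j) x.
Proof.
move=> df dg; apply/rowP => k.
have := @is_diff_lincomb R^o m a (eta 0) f g x df dg => H.
rewrite !mxE summxE diff_val; congr (_ + _).
by apply: eq_bigr => j _; rewrite !mxE.
Qed.

Lemma hess_lincomb m (a : R) (eta : 'rV[R]_m) (f : X -> R) (g : 'I_m -> X -> R) (x u : X) :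
  (\forall y \near x, differentiable f y /\ forall j, differentiable (g j) y) ->
  differentiable (grad f) x -> (forall j, differentiable (grad (g j)) x) ->
  u *m hess (fun y => a * f y + \sum_(j < m) eta 0 j * g j y) x =
    a *: (u *m hess f x) + \sum_(j < m) eta 0 j *: (u *m hess (g j) x).
Proof.
move=> fg df dg.
have H := @is_diff_lincomb _ m a (fun j => eta 0 j) (grad f) (fun j => grad (g j)) x df dg.
have near_grad : \forall y \near x,
    a *: grad f y + \sum_(j < m) eta 0 j *: grad (g j) y =
    grad (fun y => a * f y + \sum_(j < m) eta 0 j * g j y) y.
  by apply: filterS fg => y [fy gy]; rewrite grad_lincomb.
have H2 := near_eq_is_diff near_grad (@ex_diff _ _ _ _ _ _ _ H).
apply: (etrans (mulmx_hess _ x u)).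
apply: (etrans (congr1 (fun h => h u) (@diff_val _ _ _ _ _ _ _ H2))).
apply: (etrans (congr1 (fun h => h u) (@diff_val _ _ _ _ _ _ _ H))).
congr (_ *: _ + _); first exact: esym (mulmx_hess f x u).
by apply: eq_bigr => j _; congr (_ *: _); exact: esym (mulmx_hess (g j) x u).
Qed.

Lemma grad_coord m (q : X -> 'rV[R]_m) x j : differentiable q x ->
  grad (fun y => q y 0 j) x = (col j (jacobian q x))^T.
Proof.
move=> dq; have H := is_diff_row_coord j dq.
apply/rowP => k; rewrite !mxE diff_val.
by rewrite -(mul_rV_lin1 ('d q x)) -rowE mxE.
Qed.

Lemma differentiable_grad_coord m (q : X -> 'rV[R]_m) x j :
  (\forall y \near x, differentiable q y) -> differentiable (jacobian q) x ->
  differentiable (grad (fun y => q y 0 j)) x.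
Proof.
move=> dq dJ.
pose f (A : 'M[R]_(n, m)) : 'rV[R]_n := (col j A)^T.
have f_lin : linear f by move=> a A B; apply/rowP => k; rewrite !mxE.
pose fM := GRing.isLinear.Build _ _ _ _ _ f_lin.
pose L : {linear 'M[R]_(n, m) -> 'rV[R]_n} := HB.pack f fM.
have Lc : continuous L.
  move=> A; apply: (proj1 (@cvg_rowP R _ (nbhs A) (nbhs_filter A) n L (L A))) => k.
  have -> : (fun z : 'M[R]_(n, m) => (L z) 0 k) = (fun z => z k j).
    by apply/funext => z; rewrite /L/= !mxE.
  by rewrite /L/= !mxE; exact: coord_continuous.
have dL : differentiable (L \o jacobian q) x.
  by apply: differentiable_comp => //; exact: linear_differentiable.
have /near_eq_is_diff : \forall y \near x,
    (L \o jacobian q) y = grad (fun y => q y 0 j) y.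
  by apply: filterS dq => y dqy; rewrite grad_coord.
by move=> /(_ dL) H; exact: ex_diff.
Qed.

Lemma coord_le_opnorm m (A : 'M[R]_(n, m)) i j : `|A i j| <= opnorm A.
Proof.
have [C C0 AC] := enorm_mulmx_bound A.
have Ai : enorm (delta_mx 0 i *m A) <= opnorm A.
  apply: ub_le_sup; last first.
    by exists (delta_mx 0 i) => //; rewrite /eball/= /enorm dot_delta mxE !eqxx/= sqrtr1.
  exists C => _ [v v1 <-]; apply: (le_trans (AC v)).
  by rewrite ler_piMr.
apply: le_trans Ai; apply: le_trans (coord_le_enorm _ j).
by rewrite -rowE mxE.
Qed.

Lemma opnorm_ge0 m (A : 'M[R]_(n, m)) : 0 <= opnorm A.
Proof.
have [C C0 AC] := enorm_mulmx_bound A.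
have : enorm (0 *m A) <= opnorm A; last by rewrite mul0mx enorm0.
apply: ub_le_sup; last by exists 0 => //=; rewrite /eball/= enorm0.
by exists C => _ [v v1 <-]; apply: (le_trans (AC v)); rewrite ler_piMr.
Qed.

End DifferentialCalculus.

(** * Blowing up at the reference point *)

Section SmallRatios.
Variables (R : realType) (T : Type) (F : set_system T).
Context {FF : Filter F}.

Lemma ratio_cvg0 (h a : T -> R) :
  (\forall z \near F, 0 < a z) ->
  (forall e, 0 < e -> \forall z \near F, `|h z| <= e * a z) ->
  h z / a z @[z --> F] --> (0 : R).
Proof.
move=> a0 ha; apply/cvgrPdist_le => e e0.
apply: filterS (filterI a0 (ha e e0)) => z /= [az hz].
by rewrite sub0r normrN normrM normfV (gtr0_norm az) ler_pdivrMr.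
Qed.

Lemma scaled_cvg0 d (h : T -> 'rV[R]_d) (a : T -> R) :
  (\forall z \near F, 0 < a z) ->
  (forall e, 0 < e -> \forall z \near F, enorm (h z) <= e * a z) ->
  (a z)^-1 *: h z @[z --> F] --> (0 : 'rV[R]_d).
Proof.
move=> a0 ha; apply: cvg_enorm0.
have : enorm (h z) / a z @[z --> F] --> (0 : R).
  apply: ratio_cvg0 => // e e0; apply: filterS (ha e e0) => z.
  by rewrite ger0_norm ?enorm_ge0.
apply: cvg_trans; apply: near_eq_cvg; apply: filterS a0 => z /= az.
by rewrite enormZ normfV gtr0_norm// mulrC.
Qed.

Lemma cvg_add0 (V : normedModType R) (f g : T -> V) (l : V) :
  f z @[z --> F] --> l -> g z - f z @[z --> F] --> (0 : V) ->
  g z @[z --> F] --> l.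
Proof.
move=> fl gf; rewrite -[l]addr0.
have -> : g = (fun z => f z + (g z - f z)).
  by apply/funext => z; rewrite addrC subrK.
exact: cvgD.
Qed.

End SmallRatios.

Section BlowUp.
Variables (R : realType) (Omega : topologicalType) (n : nat).
Local Notation X := 'rV[R]_n.
Variables (xb : X) (wb : Omega) (u : X).
Variable F : set_system (X * Omega).
Context {FF : ProperFilter F}.
Hypothesis Fnear : nbhs (xb, wb) `<=` F.
Local Notation t z := (enorm (z.1 - xb)).
Hypothesis tpos : \forall z \near F, 0 < t z.
Hypothesis u_lim : (t z)^-1 *: (z.1 - xb) @[z --> F] --> u.

Lemma blowup_scale_cvg0 : t z @[z --> F] --> (0 : R).
Proof.
apply/cvgrPdist_lt => e e0; apply: Fnear.
exists ([set x | enorm (x - xb) < e], setT) => /=.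
  by split; [apply/near_enormP; exists e|exact: filterT].
by move=> [x w] /= [xe _]; rewrite sub0r normrN ger0_norm ?enorm_ge0.
Qed.

Section Function.
Variable phi : X * Omega -> R.
Local Notation slice w := (fun y => phi (y, w)).
Hypothesis phi_diff : \forall z \near (xb, wb),
  differentiable (slice z.2) z.1 /\ differentiable (grad (slice z.2)) z.1.
Hypothesis hess_cont : {for (xb, wb), continuous (fun z => hess (slice z.2) z.1)}.
Local Notation H := (hess (slice wb) xb).

Lemma blowup_grad :
  (t z)^-1 *: (grad (slice z.2) z.1 - grad (slice z.2) xb) @[z --> F] --> u *m H.
Proof.
have uH : ((t z)^-1 *: (z.1 - xb)) *m H @[z --> F] --> u *m H by exact: cvg_mulmx.
 apply: (@cvg_add0 R _ F _ 'rV[R]_n _ _ _ uH).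
have -> : (fun z : X * Omega => (t z)^-1 *: (grad (slice z.2) z.1 - grad (slice z.2) xb)
    - ((t z)^-1 *: (z.1 - xb)) *m H) =
  (fun z => (t z)^-1 *: (grad (slice z.2) z.1 - grad (slice z.2) xb - (z.1 - xb) *m H)).
  by apply/funext => z; rewrite -scalemxAl -scalerBr.
by apply: scaled_cvg0 => // e e0; apply: Fnear; exact: grad_taylor.
Qed.

Lemma blowup_second_order :
  (phi z - phi (xb, z.2) - dot (grad (slice z.2) xb) (z.1 - xb)) / t z ^+ 2
    @[z --> F] --> 2^-1 * quad H u.
Proof.
have uH : 2^-1 * quad H ((t z)^-1 *: (z.1 - xb)) @[z --> F] --> 2^-1 * quad H u.
  apply: cvgM; first exact: cvg_cst.
  by apply: cvg_dot u_lim; exact: cvg_mulmx.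
apply: (cvg_add0 uH).
have -> : (fun z : X * Omega => (phi z - phi (xb, z.2) - dot (grad (slice z.2) xb) (z.1 - xb))
    / t z ^+ 2 - 2^-1 * quad H ((t z)^-1 *: (z.1 - xb))) =
  (fun z => (phi z - phi (xb, z.2) - dot (grad (slice z.2) xb) (z.1 - xb) -
    2^-1 * quad H (z.1 - xb)) / t z ^+ 2).
  apply/funext => z; rewrite [RHS]mulrBl; congr (_ - _).
  by rewrite /quad -scalemxAl dotZl dotZr -exprVn expr2; ring.
apply: ratio_cvg0; first by apply: filterS tpos => z; exact: exprn_gt0.
by move=> e e0; apply: Fnear; exact: second_order_taylor.
Qed.

End Function.

End BlowUp.

(** * Multipliers at nearby stationary points *)

Section ApproximateStationarity.
Variables (R : realType) (Omega : topologicalType) (n mI mE mC : nat).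
Variable p : mpec R Omega n mI mE mC.
Local Notation X := 'rV[R]_n.
Local Notation P := (@Pset R mI mE mC).

Lemma normal_signs_near (y y' : 'rV[R]_(mI + (mE + (mC + mC)))) r eta :
  (forall j, y 0 j != 0 -> r <= `|y 0 j|) -> enorm (y' - y) < r ->
  normal_signs y' eta -> normal_signs y eta.
Proof.
move=> gap yy' [compl g0 EC]; split=> // j yj; apply: compl.
apply/eqP => y'j; have := le_lt_trans (coord_le_enorm (y' - y) j) yy'.
by rewrite !mxE y'j sub0r normrN ltNge gap.
Qed.

(** Both notions of stationarity provide a regular normal of [P] at a point close
    to [mq p (x, w)] with a small stationarity residual: the first one by the
    fuzzy chain rule, the second one by the definition of limiting normals.
    Metric regularity bounds it, and its sign conditions pass to
    [mq p (x, w)], since nonzero coordinates stay nonzero nearby. *)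
Lemma approximate_multiplier (x : X) (w : Omega) kappa delta :
  0 < kappa -> 0 < delta ->
  (Sol p w `|` SolM p w) x ->
  metrically_regular (Mmap p w) kappa x 0 ->
  differentiable (fun y => mq p (y, w)) x ->
  exists eta, [/\ normal_signs (mq p (x, w)) eta,
    enorm (gradf p x w + eta *m (jacq p x w)^T) <= delta &
    enorm eta <= kappa * (enorm (gradf p x w) + delta)].
Proof.
move=> k0 d0 Sx mr dq.
set y := mq p (x, w); set J := jacq p x w; set a := gradf p x w.
have [r1 r10 gap] := nonzero_coord_gap y.
have [r2 r20 bnd] := normal_bound k0 mr dq.
pose d := Num.min delta (Num.min r1 r2).
have dd0 : 0 < d by rewrite !lt_min d0 r10.
suff [y' [eta [Py' yy' etaN res]]] : exists y' eta,
    [/\ P y', enorm (y' - y) < d, frechet_normal y' P eta & enorm (a + eta *m J^T) < d].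
  move: yy' res; rewrite !lt_min => /and3P[_ yr1 yr2] /and3P[resd _ _].
  exists eta; split; [|exact: ltW|].
    exact: (normal_signs_near gap yr1) (frechet_normal_signs Py' etaN).
  apply: (le_trans (bnd _ _ Py' yr2 etaN)); rewrite ler_pM2l//.
  have -> : eta *m (jacobian (fun x => mq p (x, w)) x)^T = (a + eta *m J^T) - a.
    by rewrite addrAC subrr add0r.
  by apply: (le_trans (enormD _ _)); rewrite enormN addrC lerD2l ltW.
case: Sx => [[xi xiN axi]|[eta0 [Py [ys [etas [ysy Pys etas0 N]]]] a0]].
  have [r3 r30 star] := Pset_star (proj1 xiN).
  have [y' [eta [Py' yy' etaN res]]] := preimage_approximate_normal k0 mr dq
    (@Pset_closed R mI mE mC) (proj1 xiN) r30 star (regular_normalP xiN) dd0.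
  exists y', eta; split => //; have -> : a = - xi by apply/eqP; rewrite -addr_eq0 axi.
  by rewrite addrC.
have ysd : \forall k \near \oo, enorm (ys k - y) < d.
  have H : ys k - y @[k --> \oo] --> y - y by apply: cvgB => //; exact: cvg_cst.
  have {}H : enorm (ys k - y) @[k --> \oo] --> enorm (y - y) by exact: cvg_enorm.
  by rewrite subrr enorm0 in H; apply: (cvgr_lt _ H).
have resd : \forall k \near \oo, enorm (a + etas k *m J^T) < d.
  have H : a + etas k *m J^T @[k --> \oo] --> a + eta0 *m J^T.
    by apply: cvgD; [exact: cvg_cst|exact: cvg_mulmx].
  have {}H : enorm (a + etas k *m J^T) @[k --> \oo] --> enorm (a + eta0 *m J^T).
    exact: cvg_enorm.
  by rewrite a0 enorm0 in H; apply: (cvgr_lt _ H).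
have [k [/= k1 k2]] := filter_ex (filterI ysd resd).
by exists (ys k), (etas k); split => //; exact: regular_normalP (N k).
Qed.

End ApproximateStationarity.

Section MultiplierIncrement.
Variables (R : realType) (T : Type) (F : set_system T) (n m : nat).
Context {FF : ProperFilter F}.
Local Notation X := 'rV[R]_n.
Variables (t : T -> R) (a : T -> X) (g : 'I_m -> T -> X).
Variables (a0 wa : X) (g0 wg : 'I_m -> X).
Variables (lam : T -> 'rV[R]_m) (lam0 : 'rV[R]_m).
Hypothesis tpos : \forall z \near F, 0 < t z.
Hypothesis t0 : t z @[z --> F] --> (0 : R).
Hypothesis a_quot : (t z)^-1 *: (a z - a0) @[z --> F] --> wa.
Hypothesis g_quot : forall j, (t z)^-1 *: (g j z - g0 j) @[z --> F] --> wg j.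
Hypothesis lam_lim : lam z @[z --> F] --> lam0.
Hypothesis res : \forall z \near F,
  enorm (a z + \sum_j lam z 0 j *: g j z) <= t z ^+ 2.

Lemma quotient_cvg (b : T -> X) (b0 wb : X) :
  (t z)^-1 *: (b z - b0) @[z --> F] --> wb -> b z @[z --> F] --> b0.
Proof.
move=> H; have : t z *: ((t z)^-1 *: (b z - b0)) @[z --> F] --> (0 : R) *: wb by exact: cvgZ.
rewrite scale0r => H0; apply: (@cvg_add0 R _ F _ X (fun=> b0)); first exact: cvg_cst.
move: H0; apply: cvg_trans; apply: near_eq_cvg; apply: filterS tpos => z /= tz.
by rewrite scalerA divff ?scale1r// gt_eqF.
Qed.

Lemma residual_quot :
  (t z)^-1 *: (a z + \sum_j lam z 0 j *: g j z) @[z --> F] --> (0 : X).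
Proof.
apply: scaled_cvg0 => // e e0.
have te : \forall z \near F, t z <= e.
  by apply: filterS (cvgr_lt _ t0 _ e0) => z; exact: ltW.
apply: filterS (filterI tpos (filterI te res)) => z /= [tz [tze h]].
by apply: (le_trans h); rewrite expr2 ler_wpM2r// ltW.
Qed.

Lemma multiplier_limit : a0 + \sum_j lam0 0 j *: g0 j = 0.
Proof.
have gq j : g j z @[z --> F] --> g0 j by exact: quotient_cvg (@g_quot j).
apply: (@limit_unique R T F _ X (fun z => a z + \sum_j lam z 0 j *: g j z)).
  apply: cvgD; first exact: quotient_cvg a_quot.
  apply: (cvg_big add_continuous) => j _; apply: cvgZ; last exact: gq.
  by move/cvg_rowP : lam_lim; exact.
apply: (@quotient_cvg _ (0 : X) (0 : X)).
have := residual_quot; apply: cvg_trans; apply: near_eq_cvg; apply: nearW => z /=.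
by rewrite subr0.
Qed.

(** Subtract the stationarity equation at the reference point from the one at [z]
    and divide by [t z]. The quotients [(lam z - lam0) / t z] may be unbounded,
    but their images under the reference gradients converge. *)
Lemma multiplier_increment :
  (\sum_j ((t z)^-1 *: (lam z - lam0)) 0 j *: g0 j) @[z --> F] -->
    - (wa + \sum_j lam0 0 j *: wg j).
Proof.
have H : (t z)^-1 *: (a z + \sum_j lam z 0 j *: g j z) - ((t z)^-1 *: (a z - a0) +
    \sum_j lam z 0 j *: ((t z)^-1 *: (g j z - g0 j))) @[z --> F] -->
    0 - (wa + \sum_j lam0 0 j *: wg j).
  apply: cvgB; first exact: residual_quot.
  apply: cvgD => //; apply: (cvg_big add_continuous) => j _; apply: cvgZ => //.
  by move/cvg_rowP : lam_lim; exact.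
rewrite -[X in _ --> X]sub0r; move: H; apply: cvg_trans; apply: near_eq_cvg; apply: nearW => z /=.
have -> : \sum_j lam z 0 j *: ((t z)^-1 *: (g j z - g0 j)) =
    (t z)^-1 *: (\sum_j lam z 0 j *: g j z - \sum_j lam z 0 j *: g0 j).
  rewrite -sumrB scaler_sumr; apply: eq_bigr => j _.
  by rewrite -scalerBr !scalerA mulrC.
rewrite -scalerDr -scalerBr.
have cancel_sums (x y v w : X) : x + y - (x - v + (y - w)) = v + w.
  by apply/rowP => k; rewrite !mxE; ring.
rewrite cancel_sums; have -> : a0 = - \sum_j lam0 0 j *: g0 j.
  by apply/eqP; rewrite -addr_eq0 multiplier_limit.
rewrite addrC -sumrB scaler_sumr; apply: eq_bigr => j _.
by rewrite -scalerBl scalerA !mxE.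
Qed.

End MultiplierIncrement.

Lemma rowB (R : realType) m (a b : 'rV[R]_m) j : (a - b) 0 j = a 0 j - b 0 j.
Proof. by rewrite !mxE. Qed.

Lemma sub_sub_cancel (V : zmodType) (a b c : V) : (a - b) - (a - c) = c - b.
Proof. by rewrite opprB addrC addrA subrK. Qed.

Lemma first_order_split (R : realType) m (gw g0 d : 'rV[R]_m) (a b c t : R) l :
  (0 < l)%N -> t != 0 ->
  t * ((a - b - dot gw d) / t ^+ 2) + t ^+ l.-1 * ((b - c) / t ^+ l) +
    t * dot (t^-1 *: (gw - g0)) (t^-1 *: d) + dot g0 (t^-1 *: d) = (a - c) / t.
Proof.
move=> l0 t0; rewrite !dotZl !dotZr dotDl dotNl.
have -> : t ^+ l = t * t ^+ l.-1 by rewrite -exprS prednK.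
move: (dot gw d) (dot g0 d) (t ^+ l.-1) (expf_neq0 l.-1 t0) => e f s s0.
by field; rewrite t0 s0.
Qed.

Lemma second_order_split (R : realType) m (gw g0 d u : 'rV[R]_m) (a b c t : R) :
  t != 0 -> dot g0 u = 0 ->
  2 * ((a - b - dot gw d) / t ^+ 2) + 2 * ((b - c) / t ^+ 2) +
    2 * dot (t^-1 *: (gw - g0)) (t^-1 *: d) =
  2 * ((a - c) / t ^+ 2) - dot g0 (2 *: (t^-1 *: (t^-1 *: d - u))).
Proof.
move=> t0 gu0; rewrite !dotZl !dotZr (dotDr _ (- u)) dotNr gu0 dotDl dotNl dotZr.
move: (dot gw d) (dot g0 d) => e f. by field.
Qed.

(** * First- and second-order expansions of the constraints *)

Section ConstraintBlowUp.
Variables (R : realType) (Omega : topologicalType) (n mI mE mC : nat).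
Variables (p : mpec R Omega n mI mE mC) (xb : 'rV[R]_n) (wb : Omega).
Local Notation X := 'rV[R]_n.
Local Notation N := (mI + (mE + (mC + mC)))%N.
Hypothesis standing : standing_assumption p xb wb.

Definition constraint (j : 'I_N) : X * Omega -> R := fun z => mq p z 0 j.
Local Notation q j w := (fun y => constraint j (y, w)).

Lemma standing_near : \forall z \near (xb, wb),
  [/\ differentiable (fun y => mf p (y, z.2)) z.1,
      differentiable (fun y => gradf p y z.2) z.1,
      differentiable (fun y => mq p (y, z.2)) z.1 &
      forall j, differentiable (q j z.2) z.1 /\ differentiable (grad (q j z.2)) z.1].
Proof.
have [U0 [W0 [[oU0 U0x] W0w D _ _]]] := standing.
exists (U0, W0) => /=; first by split=> //; exact: open_nbhs_nbhs.
move=> [x w] /= [Ux Ww]; have [df dgf dq dJ] := D x w Ux Ww.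
split; [exact: df|exact: dgf|exact: dq|move=> j; split].
  by have H := is_diff_row_coord j dq; exact: ex_diff.
apply: differentiable_grad_coord dJ.
have : nbhs x U0 by apply: open_nbhs_nbhs.
by apply: filterS => y Uy; have [] := D y w Uy Ww.
Qed.

Lemma objective_diff : \forall z \near (xb, wb),
  differentiable (fun y => mf p (y, z.2)) z.1 /\
  differentiable (grad (fun y => mf p (y, z.2))) z.1.
Proof. by apply: filterS standing_near => z []. Qed.

Lemma constraint_diff j : \forall z \near (xb, wb),
  differentiable (q j z.2) z.1 /\ differentiable (grad (q j z.2)) z.1.
Proof. by apply: filterS standing_near => z [_ _ _ /(_ j)]. Qed.

Variables (l : nat) (F : set_system (X * Omega)) (u : X).
Context {FF : ProperFilter F}.
Hypothesis l0 : (0 < l)%N.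
Hypothesis Fnear : nbhs (xb, wb) `<=` F.
Local Notation t z := (enorm (z.1 - xb)).
Hypothesis tpos : \forall z \near F, 0 < t z.
Hypothesis u_lim : (t z)^-1 *: (z.1 - xb) @[z --> F] --> u.
Hypothesis tau_small : forall e, 0 < e -> \forall z \near F, tau p xb wb l z.2 <= e * t z.

Lemma err_ge0 w : 0 <= err p xb wb l w.
Proof. by rewrite addr_ge0 ?opnorm_ge0 ?powR_ge0. Qed.

Lemma err_le_tau w : err p xb wb l w <= tau p xb wb l w.
Proof. by rewrite lerDr enorm_ge0. Qed.

Lemma objective_shift :
  (t z)^-1 *: (gradf p xb z.2 - gradf p xb wb) @[z --> F] --> (0 : X).
Proof.
apply: scaled_cvg0 => // e e0; apply: filterS (tau_small e0) => z.
by apply: le_trans; rewrite lerDl err_ge0.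
Qed.

Lemma constraint_grad_shift j :
  (t z)^-1 *: (grad (q j z.2) xb - grad (q j wb) xb) @[z --> F] --> (0 : X).
Proof.
have dq : \forall z \near (xb, wb), differentiable (fun y => mq p (y, z.2)) xb.
  apply: filterS (near_segment standing_near) => z /(_ 0).
  by rewrite lexx ler01 scale0r addr0 => /(_ isT)[].
have dqb : differentiable (fun y => mq p (y, wb)) xb by exact: nbhs_singleton dq.
apply: scaled_cvg0 => // e e0.
have e1 : 0 < e / n.+1%:R by rewrite divr_gt0.
apply: filterS (filterI (Fnear dq) (tau_small e1)) => z /= [dqz taue].
rewrite (grad_coord j dqz) (grad_coord j dqb).
apply: (le_trans (enorm_le_sum _)).
apply: (@le_trans _ _ (\sum_(i < n) tau p xb wb l z.2)).
  apply: ler_sum => i _; rewrite !mxE.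
  have := coord_le_opnorm (jacq p xb z.2 - jacq p xb wb) i j; rewrite !mxE.
  move=> /le_trans; apply; apply: le_trans (err_le_tau _).
  by rewrite lerDl powR_ge0.
rewrite sumr_const card_ord.
apply: (@le_trans _ _ (e / n.+1%:R * t z *+ n)); first by rewrite lerMn2r taue orbT.
rewrite -[leLHS]mulr_natl mulrA ler_wpM2r ?enorm_ge0//.
by rewrite mulrCA ler_piMr ?(ltW e0)// ler_pdivrMr// mul1r ler_nat.
Qed.

(** Here the exponent [1 / l] in the error bound matters: a bound on the root of
    the shift by [o(t)] makes the shift itself [o(t ^ l)]. *)
Lemma constraint_shift j :
  (constraint j (xb, z.2) - constraint j (xb, wb)) / t z ^+ l @[z --> F] --> (0 : R).
Proof.
apply: ratio_cvg0; first by apply: filterS tpos => z; exact: exprn_gt0.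
move=> e e0; pose d := Num.min e 1.
have d0 : 0 < d by rewrite lt_min e0 ltr01.
apply: filterS (filterI tpos (tau_small d0)) => z /= [tz taue].
set v := mq p (xb, z.2) - mq p (xb, wb).
have -> : constraint j (xb, z.2) - constraint j (xb, wb) = v 0 j by rewrite rowB.
apply: (le_trans (coord_le_enorm _ _)).
have root : enorm v `^ (l%:R^-1) <= d * t z.
  apply: le_trans taue; apply: le_trans (err_le_tau _).
  by rewrite lerDr opnorm_ge0.
have -> : enorm v = (enorm v `^ (l%:R^-1)) ^+ l.
  rewrite -powR_mulrn ?powR_ge0// -powRrM mulVf ?powRr1 ?enorm_ge0//.
  by rewrite pnatr_eq0 -lt0n.
apply: (@le_trans _ _ ((d * t z) ^+ l)).
  by rewrite lerXn2r ?nnegrE ?powR_ge0// mulr_ge0 ?(ltW d0) ?(ltW tz).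
rewrite exprMn ler_wpM2r ?exprn_ge0 ?(ltW tz)//.
apply: (@le_trans _ _ (d ^+ 1)); last by rewrite expr1 ge_min lexx.
by rewrite ler_wiXn2l// ?(ltW d0)// ge_min lexx orbT.
Qed.

Lemma objective_quotient :
  (t z)^-1 *: (gradf p z.1 z.2 - gradf p xb wb) @[z --> F] --> u *m hessf p xb wb.
Proof.
have [_ [_ [_ _ _ [_ _ _ hc _] _]]] := standing.
have H : (t z)^-1 *: (gradf p z.1 z.2 - gradf p xb z.2) @[z --> F] -->
    u *m hessf p xb wb.
  exact: (@blowup_grad R Omega n xb wb u F _ Fnear tpos u_lim (mf p) objective_diff hc).
apply: (@cvg_add0 R _ F _ X _ _ _ H); have := objective_shift.
apply: cvg_trans; apply: near_eq_cvg; apply: nearW => z.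
by rewrite -scalerBr sub_sub_cancel.
Qed.

Lemma constraint_quotient j :
  (t z)^-1 *: (grad (q j z.2) z.1 - grad (q j wb) xb) @[z --> F] -->
  u *m hess (q j wb) xb.
Proof.
have [_ [_ [_ _ _ [_ _ _ _ hc] _]]] := standing.
have H : (t z)^-1 *: (grad (q j z.2) z.1 - grad (q j z.2) xb) @[z --> F] -->
    u *m hess (q j wb) xb.
  exact: (@blowup_grad R Omega n xb wb u F _ Fnear tpos u_lim (constraint j)
    (constraint_diff j) (hc j)).
apply: (@cvg_add0 R _ F _ X _ _ _ H); have := constraint_grad_shift j.
apply: cvg_trans; apply: near_eq_cvg; apply: nearW => z.
by rewrite -scalerBr sub_sub_cancel.
Qed.

Lemma constraint_second_order j :
  (constraint j z - constraint j (xb, z.2) - dot (grad (q j z.2) xb) (z.1 - xb)) / t z ^+ 2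
    @[z --> F] --> 2^-1 * quad (hess (q j wb) xb) u.
Proof.
have [_ [_ [_ _ _ [_ _ _ _ hc] _]]] := standing.
exact: (@blowup_second_order R Omega n xb wb u F _ Fnear tpos u_lim (constraint j)
  (constraint_diff j) (hc j)).
Qed.

Lemma scale_cvg0 : t z @[z --> F] --> (0 : R).
Proof. exact: blowup_scale_cvg0 Fnear. Qed.

Lemma constraint_first_order j :
  (constraint j z - constraint j (xb, wb)) / t z @[z --> F] -->
  dot (grad (q j wb) xb) u.
Proof.
have H2 : t z * ((constraint j z - constraint j (xb, z.2) -
    dot (grad (q j z.2) xb) (z.1 - xb)) / t z ^+ 2) @[z --> F] -->
    0 * (2^-1 * quad (hess (q j wb) xb) u).
  by apply: cvgM; [exact: scale_cvg0|exact: constraint_second_order].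
have H3 : t z ^+ l.-1 * ((constraint j (xb, z.2) - constraint j (xb, wb)) / t z ^+ l)
    @[z --> F] --> (0 : R) ^+ l.-1 * 0.
  by apply: cvgM (@constraint_shift j); exact: (@cvg_comp _ _ _ (fun z : X * Omega => t z)
    (fun x : R => x ^+ l.-1) _ _ _ scale_cvg0 (@exprn_continuous R l.-1 0)).
have H4 : t z * dot ((t z)^-1 *: (grad (q j z.2) xb - grad (q j wb) xb))
    ((t z)^-1 *: (z.1 - xb)) @[z --> F] --> 0 * dot 0 u.
  by apply: cvgM; [exact: scale_cvg0|apply: cvg_dot => //; exact: constraint_grad_shift].
have H5 : dot (grad (q j wb) xb) ((t z)^-1 *: (z.1 - xb)) @[z --> F] -->
    dot (grad (q j wb) xb) u by apply: cvg_dot => //; exact: cvg_cst.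
have F' : Filter F by exact: filter_filter.
have H6 := cvgD (cvgD (cvgD H2 H3) H4) H5; move: (H6 F' F' F').
rewrite !mul0r mulr0 !add0r.
apply: cvg_trans; apply: near_eq_cvg; apply: filterS tpos => z /= tz.
by apply: first_order_split => //; rewrite gt_eqF.
Qed.

(** The second-order quotient need not be bounded, because the difference between
    the directions and [u] may tend to zero more slowly than the scale. Subtracting
    the image of this difference leaves the curvature. *)
Lemma constraint_curvature j : l = 2%N -> dot (grad (q j wb) xb) u = 0 ->
  2 * ((constraint j z - constraint j (xb, wb)) / t z ^+ 2) -
    dot (grad (q j wb) xb) (2 *: ((t z)^-1 *: ((t z)^-1 *: (z.1 - xb) - u)))
    @[z --> F] --> quad (hess (q j wb) xb) u.
Proof.
move=> l2 gu0.
have H2 : 2 * ((constraint j z - constraint j (xb, z.2) -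
    dot (grad (q j z.2) xb) (z.1 - xb)) / t z ^+ 2) @[z --> F] -->
    2 * (2^-1 * quad (hess (q j wb) xb) u).
  by apply: cvgM; [exact: cvg_cst|exact: constraint_second_order].
have H3 : 2 * ((constraint j (xb, z.2) - constraint j (xb, wb)) / t z ^+ 2)
    @[z --> F] --> (2 : R) * 0.
  by apply: cvgM; [exact: cvg_cst|have := @constraint_shift j; rewrite l2].
have H4 : 2 * dot ((t z)^-1 *: (grad (q j z.2) xb - grad (q j wb) xb))
    ((t z)^-1 *: (z.1 - xb)) @[z --> F] --> 2 * dot 0 u.
  by apply: cvgM; [exact: cvg_cst|apply: cvg_dot => //; exact: constraint_grad_shift].
have F' : Filter F by exact: filter_filter.
have H5 := cvgD (cvgD H2 H3) H4; move: (H5 F' F'); rewrite dot0l !mulr0 !addr0 mulrA divff ?mul1r//.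
apply: cvg_trans; apply: near_eq_cvg; apply: filterS tpos => z /= tz.
by apply: second_order_split => //; rewrite gt_eqF.
Qed.

End ConstraintBlowUp.

(** * The Lagrangian and the index sets in stacked coordinates *)

Section ReferenceData.
Variables (R : realType) (Omega : topologicalType) (n mI mE mC : nat).
Variables (p : mpec R Omega n mI mE mC) (xb : 'rV[R]_n) (wb : Omega).
Local Notation X := 'rV[R]_n.
Local Notation N := (mI + (mE + (mC + mC)))%N.
Local Notation q j w := (fun y => constraint p j (y, w)).
Local Notation gb j := (grad (q j wb) xb).
Local Notation Hb j := (hess (q j wb) xb).
Local Notation idx_g := (@idx_g mI mE mC).
Local Notation idx_h := (@idx_h mI mE mC).
Local Notation idx_G := (@idx_G mI mE mC).
Local Notation idx_H := (@idx_H mI mE mC).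

Definition multiplier_of (eta : 'rV[R]_N) : multiplier R mI mE mC :=
  Multiplier (lsubmx eta) (lsubmx (rsubmx eta)) (lsubmx (rsubmx (rsubmx eta)))
    (rsubmx (rsubmx (rsubmx eta))).

Lemma lg_of eta i : lg (multiplier_of eta) 0 i = eta 0 (idx_g i).
Proof. by rewrite /= mxE. Qed.
Lemma lh_of eta i : lh (multiplier_of eta) 0 i = eta 0 (idx_h i).
Proof. by rewrite /= !mxE. Qed.
Lemma lG_of eta i : lG (multiplier_of eta) 0 i = eta 0 (idx_G i).
Proof. by rewrite /= !mxE. Qed.
Lemma lH_of eta i : lH (multiplier_of eta) 0 i = eta 0 (idx_H i).
Proof. by rewrite /= !mxE. Qed.

Lemma constraint_g i z : constraint p (idx_g i) z = mg p z 0 i.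
Proof. by rewrite /constraint /mq row_mxEl. Qed.
Lemma constraint_h i z : constraint p (idx_h i) z = mh p z 0 i.
Proof. by rewrite /constraint /mq row_mxEr row_mxEl. Qed.
Lemma constraint_G i z : constraint p (idx_G i) z = - mG p z 0 i.
Proof. by rewrite /constraint /mq !row_mxEr row_mxEl mxE. Qed.
Lemma constraint_H i z : constraint p (idx_H i) z = - mH p z 0 i.
Proof. by rewrite /constraint /mq !row_mxEr mxE. Qed.

Lemma lagrangian_of l0 eta y w :
  lagrangian p l0 y (multiplier_of eta) w =
  l0 * mf p (y, w) + \sum_j eta 0 j * constraint p j (y, w).
Proof.
rewrite /lagrangian !big_split_ord/= -!addrA; congr (_ + (_ + (_ + _))).
- by apply: eq_bigr => i _; rewrite lg_of -constraint_g.
- by apply: eq_bigr => i _; rewrite lh_of -constraint_h.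
rewrite big_split/= opprD -!sumrN; congr (_ + _); apply: eq_bigr => i _.
- by rewrite lG_of -mulrN -constraint_G.
- by rewrite lH_of -mulrN -constraint_H.
Qed.

Hypothesis standing : standing_assumption p xb wb.

Lemma near_reference (A : set (X * Omega)) :
  (\forall z \near (xb, wb), A z) -> \forall x \near xb, A (x, wb).
Proof.
move=> [[U W] /= [nU nW] UW]; apply: filterS nU => x Ux; apply: UW; split => //=.
exact: nbhs_singleton.
Qed.

Lemma reference_diff : \forall x \near xb,
  differentiable (fun y => mf p (y, wb)) x /\ forall j, differentiable (q j wb) x.
Proof.
apply: filterS (near_reference (standing_near standing)) => x /= [df _ _ dq].
by split; [exact: df|move=> j; exact: (proj1 (dq j))].
Qed.

Lemma reference_diff2 :
  differentiable (grad (fun y => mf p (y, wb))) xb /\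
  forall j, differentiable (grad (q j wb)) xb.
Proof.
have /= [_ d2f _ dq] := nbhs_singleton (near_reference (standing_near standing)).
by split; [exact: d2f|move=> j; exact: (proj2 (dq j))].
Qed.

Lemma gradL_of l0 eta :
  gradL p l0 xb (multiplier_of eta) wb =
  l0 *: gradf p xb wb + \sum_j eta 0 j *: gb j.
Proof.
have [df dq] := nbhs_singleton reference_diff.
rewrite /gradL -(grad_lincomb l0 eta df dq); congr (grad _ xb).
by apply/funext => y; exact: lagrangian_of.
Qed.

Lemma hessL_of l0 eta (u : X) :
  u *m hessL p l0 xb (multiplier_of eta) wb =
  l0 *: (u *m hessf p xb wb) + \sum_j eta 0 j *: (u *m Hb j).
Proof.
have [d2f d2q] := reference_diff2.
rewrite -(hess_lincomb l0 eta u reference_diff d2f d2q).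
rewrite /hessL; congr (_ *m hess _ xb).
by apply/funext => y; exact: lagrangian_of.
Qed.

Lemma grad_opp (f : X -> R) (x : X) : differentiable f x ->
  grad (fun y => - f y) x = - grad f x.
Proof.
move=> df; have := @grad_lincomb R n 0 (-1) 0 f (fun _ => f) x df (fun _ => df).
rewrite big_ord0 addr0 scaleN1r => <-; congr (grad _ x).
by apply/funext => y; rewrite big_ord0 addr0 mulN1r.
Qed.

Lemma quad_hess_opp (f : X -> R) (x v : X) :
  (\forall y \near x, differentiable f y) -> differentiable (grad f) x ->
  quad (hess (fun y => - f y) x) v = - quad (hess f x) v.
Proof.
move=> df dgf; rewrite /quad -dotNl; congr (dot _ v).
have := @hess_lincomb R n 0 (-1) 0 f (fun _ => f) x v _ dgf (fun _ => dgf).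
rewrite big_ord0 addr0 scaleN1r => <-; last by apply: filterS df.
congr (v *m hess _ x).
by apply/funext => y; rewrite big_ord0 addr0 mulN1r.
Qed.

Lemma qdiff j : \forall y \near xb, differentiable (q j wb) y.
Proof. by apply: filterS reference_diff => y [_]. Qed.

Lemma component_g i : component (mg p) i wb = q (idx_g i) wb.
Proof. by apply/funext => y; rewrite /component constraint_g. Qed.
Lemma component_h i : component (mh p) i wb = q (idx_h i) wb.
Proof. by apply/funext => y; rewrite /component constraint_h. Qed.
Lemma component_G i : component (mG p) i wb = (fun y => - constraint p (idx_G i) (y, wb)).
Proof. by apply/funext => y; rewrite /component constraint_G opprK. Qed.
Lemma component_H i : component (mH p) i wb = (fun y => - constraint p (idx_H i) (y, wb)).
Proof. by apply/funext => y; rewrite /component constraint_H opprK. Qed.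

Lemma dgE i v : dg p xb wb i v = dot (gb (idx_g i)) v.
Proof. by rewrite /dg component_g. Qed.
Lemma dhE i v : dh p xb wb i v = dot (gb (idx_h i)) v.
Proof. by rewrite /dh component_h. Qed.
Lemma dGE i v : dG p xb wb i v = - dot (gb (idx_G i)) v.
Proof. by rewrite /dG component_G grad_opp ?dotNl//; exact: nbhs_singleton (qdiff _). Qed.
Lemma dHE i v : dH p xb wb i v = - dot (gb (idx_H i)) v.
Proof. by rewrite /dH component_H grad_opp ?dotNl//; exact: nbhs_singleton (qdiff _). Qed.
Lemma d2gE i v : d2g p xb wb i v = quad (Hb (idx_g i)) v.
Proof. by rewrite /d2g component_g. Qed.
Lemma d2hE i v : d2h p xb wb i v = quad (Hb (idx_h i)) v.
Proof. by rewrite /d2h component_h. Qed.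
Lemma d2GE i v : d2G p xb wb i v = - quad (Hb (idx_G i)) v.
Proof.
by rewrite /d2G component_G; exact: quad_hess_opp (qdiff _) (proj2 reference_diff2 _).
Qed.
Lemma d2HE i v : d2H p xb wb i v = - quad (Hb (idx_H i)) v.
Proof.
by rewrite /d2H component_H; exact: quad_hess_opp (qdiff _) (proj2 reference_diff2 _).
Qed.

End ReferenceData.

(** * Reading the systems off the signs at one nearby point *)

Section SignTransfer.
Variable R : realType.
Implicit Types a b c : R.

Lemma same_sign_gt0 a b : 0 < a * b -> 0 <= b -> 0 < a.
Proof.
move=> ab b0; rewrite ltNge; apply/negP => a0.
by move: ab; rewrite ltNge mulr_le0_ge0.
Qed.

Lemma same_sign_lt0 a b : 0 < a * b -> b <= 0 -> a < 0.
Proof. by move=> ab b0; rewrite -oppr_gt0 (@same_sign_gt0 _ (- b)) ?mulrNN ?oppr_ge0. Qed.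

Lemma same_sign_neq0 a b : 0 < a * b -> b != 0.
Proof. by move=> ab; apply: contraTneq ab => ->; rewrite mulr0 ltxx. Qed.

Lemma EC_conformal a b a' b' : EC_normal a b ->
  (a' != 0 -> 0 < a' * a) -> (b' != 0 -> 0 < b' * b) -> EC_normal a' b'.
Proof.
move=> EC Ha Hb.
have [->|a'0] := eqVneq a' 0; first by right; rewrite mul0r.
have [->|b'0] := eqVneq b' 0; first by right; rewrite mulr0.
have [pa pb] := (Ha a'0, Hb b'0); case: EC => [[a0 b0]|/eqP].
  by left; split; [exact: (same_sign_gt0 pa (ltW a0))|exact: (same_sign_gt0 pb (ltW b0))].
by rewrite mulf_eq0 (negbTE (same_sign_neq0 pa)) (negbTE (same_sign_neq0 pb)).
Qed.

(** The first component of a normal is nonnegative if the second one is positive,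
    and zero if it is negative; [c] and [b] have the signs of these components. *)
Lemma EC_increment a' b' b c : EC_normal a' b' ->
  0 < b * b' -> (c != 0 -> 0 < c * a') ->
  (0 < b -> 0 <= c) /\ (b < 0 -> c = 0).
Proof.
move=> EC bb Hc; have [->|c0] := eqVneq c 0; first by split.
have pc := Hc c0; case: EC => [[a0 b0]|/eqP].
  have c_gt0 := same_sign_gt0 pc (ltW a0).
  by have := same_sign_gt0 bb (ltW b0); split=> [_|]; [exact: ltW|lra].
by rewrite mulf_eq0 (negbTE (same_sign_neq0 pc)) (negbTE (same_sign_neq0 bb)).
Qed.

Lemma EC_normalC a b : EC_normal a b -> EC_normal b a.
Proof. by case=> [[a0 b0]|ab]; [left|right; rewrite mulrC]. Qed.

Lemma QEC_tangent_apex (z : 'rV[R]_2) :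
  @QEC R z -> tangent_cone (row2 0 0) (@QEC R) z.
Proof.
move=> [z0 z1 zz]; have E t j : (row2 0 0 + t *: z) 0 j = t * z 0 j.
  by rewrite !mxE; case: ifP => _; rewrite add0r.
split; first by apply/QEC_row2; rewrite mulr0 lexx.
exists (fun=> z), (fun k => k.+1%:R^-1); split.
- exact: cvg_cst.
- by move=> k; rewrite invr_gt0.
- exact: cvg_harmonic.
- move=> k; have k0 : 0 <= k.+1%:R^-1 :> R by rewrite invr_ge0.
  split; rewrite !E; [exact: mulr_ge0_le0|exact: mulr_ge0_le0|].
  by rewrite mulrACA zz mulr0.
Qed.

End SignTransfer.

Section SignPattern.
Variables (R : realType) (Omega : topologicalType) (n mI mE mC : nat).
Variables (p : mpec R Omega n mI mE mC) (xb : 'rV[R]_n) (wb : Omega).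
Local Notation X := 'rV[R]_n.
Local Notation N := (mI + (mE + (mC + mC)))%N.
Local Notation Y := 'rV[R]_N.
Local Notation q j w := (fun y => constraint p j (y, w)).
Local Notation gb j := (grad (q j wb) xb).
Local Notation Hb j := (hess (q j wb) xb).
Local Notation yb := (mq p (xb, wb)).
Local Notation idx_g := (@idx_g mI mE mC).
Local Notation idx_h := (@idx_h mI mE mC).
Local Notation idx_G := (@idx_G mI mE mC).
Local Notation idx_H := (@idx_H mI mE mC).
Hypothesis standing : standing_assumption p xb wb.
Hypothesis feas : feasible p wb xb.
Variables (u : X) (y eta lam : Y).
Hypothesis Py : @Pset R mI mE mC y.
Hypothesis y_inactive : forall j, yb 0 j != 0 -> 0 < yb 0 j * y 0 j.
Hypothesis y_active : forall j, yb 0 j = 0 -> dot (gb j) u != 0 ->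
  0 < dot (gb j) u * y 0 j.
Hypothesis eta_normal : normal_signs y eta.
Hypothesis lam_eta : conformal lam eta.

(** The constraints that are tight at [xb] and stay tight to first order along
    [u]: the multipliers and their increments live on these coordinates only,
    and only these are constrained to second order. *)
Definition active j := (yb 0 j == 0) && (dot (gb j) u == 0).

Lemma yb_g i : yb 0 (idx_g i) = mg p (xb, wb) 0 i.
Proof. exact: constraint_g. Qed.
Lemma yb_G i : yb 0 (idx_G i) = - mG p (xb, wb) 0 i.
Proof. exact: constraint_G. Qed.
Lemma yb_H i : yb 0 (idx_H i) = - mH p (xb, wb) 0 i.
Proof. exact: constraint_H. Qed.

Lemma inactive_neq0 j : ~~ active j -> y 0 j != 0.
Proof.
rewrite /active negb_and; have [yj0|yj0 _] := eqVneq (yb 0 j) 0; last first.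
  exact: same_sign_neq0 (y_inactive yj0).
by move=> /(y_active yj0)/same_sign_neq0.
Qed.

Lemma inactive_eta j : ~~ active j -> eta 0 j = 0.
Proof. by move=> /inactive_neq0; have [H _ _] := eta_normal; exact: H. Qed.

Lemma inactive_lam j : ~~ active j -> lam 0 j = 0.
Proof.
move=> /inactive_eta e0; apply/eqP; apply/negPn/negP => /lam_eta.
by rewrite e0 mulr0 ltxx.
Qed.

Lemma lam_neq0_active j : lam 0 j != 0 -> active j /\ y 0 j = 0.
Proof.
move=> lj; have ej := same_sign_neq0 (lam_eta lj); split.
  by apply: contraNT lj => /inactive_lam ->.
by apply/eqP; apply: contraNT ej => yj; have [H _ _] := eta_normal; rewrite H.
Qed.

Lemma active_Igu i : Igu p xb wb u i <-> active (idx_g i).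
Proof.
rewrite /Igu/Ig/= dgE -yb_g /active.
by split=> [[-> ->]|/andP[/eqP -> /eqP ->]]; rewrite ?eqxx.
Qed.

Lemma active_I00u i : I00u p xb wb u i -> active (idx_G i) /\ active (idx_H i).
Proof.
move=> [[G0 H0]]; rewrite (dGE standing) (dHE standing) => dG0 dH0.
have zero_opp (a : R) : - a = 0 -> a == 0 by move/eqP; rewrite oppr_eq0.
rewrite /active yb_G yb_H G0 H0 oppr0 !eqxx.
by split; [exact: zero_opp dG0|exact: zero_opp dH0].
Qed.

Lemma inactive_H i : (I0p p xb wb `|` I0pu p xb wb u) i -> ~~ active (idx_H i).
Proof.
rewrite /active yb_H oppr_eq0 => -[[_ H0]|[_ _]]; first by rewrite gt_eqF.
by rewrite (dHE standing) oppr_gt0 => /lt_eqF ->; rewrite andbF.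
Qed.

Lemma inactive_G i : (Ip0 p xb wb `|` Ip0u p xb wb u) i -> ~~ active (idx_G i).
Proof.
rewrite /active yb_G oppr_eq0 => -[[G0 _]|[_ + _]]; first by rewrite gt_eqF.
by rewrite (dGE standing) oppr_gt0 => /lt_eqF ->; rewrite andbF.
Qed.

Lemma Tlin_of_pattern : Tlin p xb wb u.
Proof.
have [yg yh yGH] := (PsetP y).1 Py; have [yg0 yh0 yGH0] := (PsetP yb).1 feas.
have d_le0 j : yb 0 j = 0 -> y 0 j <= 0 -> dot (gb j) u <= 0.
  move=> yj yle; have [->//|dj] := eqVneq (dot (gb j) u) 0.
  exact: ltW (same_sign_lt0 (y_active yj dj) yle).
have d_eq0 j : yb 0 j = 0 -> y 0 j = 0 -> dot (gb j) u = 0.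
  move=> yj y0; apply/eqP; apply/negPn/negP => /(y_active yj).
  by rewrite y0 mulr0 ltxx.
have prod0 i : y 0 (idx_G i) * y 0 (idx_H i) = 0 by case: (yGH i).
split=> [i|i|i [G0 H0]|i [G0 H0]|i [G0 H0]].
- by rewrite /Ig/= -yb_g dgE => gi; exact: d_le0.
- by rewrite dhE; exact: d_eq0.
- have /y_inactive/same_sign_neq0 yH : yb 0 (idx_H i) != 0.
    by rewrite yb_H oppr_eq0 gt_eqF.
  rewrite (dGE standing) d_eq0 ?oppr0//; first by rewrite yb_G G0 oppr0.
  by move/eqP: (prod0 i); rewrite mulf_eq0 (negbTE yH) orbF => /eqP.
- have /y_inactive/same_sign_neq0 yG : yb 0 (idx_G i) != 0.
    by rewrite yb_G oppr_eq0 gt_eqF.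
  rewrite (dHE standing) d_eq0 ?oppr0//; first by rewrite yb_H H0 oppr0.
  by move/eqP: (prod0 i); rewrite mulf_eq0 (negbTE yG) => /eqP.
- have G0' : yb 0 (idx_G i) = 0 by rewrite yb_G G0 oppr0.
  have H0' : yb 0 (idx_H i) = 0 by rewrite yb_H H0 oppr0.
  have [yG yH _] := yGH i.
  have -> : - row2 (dG p xb wb i u) (dH p xb wb i u) =
      row2 (dot (gb (idx_G i)) u) (dot (gb (idx_H i)) u).
    rewrite (dGE standing) (dHE standing).
    by apply/rowP => j; rewrite !mxE; case: ifP; rewrite opprK.
  apply/QEC_row2; split; [exact: d_le0|exact: d_le0|].
  apply/eqP; rewrite mulf_eq0; apply/negPn/negP; rewrite negb_or => /andP[dG0 dH0].
  have := same_sign_neq0 (y_active G0' dG0); have := same_sign_neq0 (y_active H0' dH0).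
  by move/eqP: (prod0 i); rewrite mulf_eq0 => /orP[] ->.
Qed.

Lemma first_order_of_pattern (mu : Y) : conformal mu (eta - lam) ->
  gradf p xb wb + \sum_j lam 0 j *: gb j = 0 ->
  \sum_j mu 0 j *: gb j = - (u *m hessf p xb wb + \sum_j lam 0 j *: (u *m Hb j)) ->
  first_order_system p xb wb u (multiplier_of lam) (multiplier_of mu).
Proof.
move=> mu_conf stat dstat.
have mu_eta j : mu 0 j != 0 -> 0 < mu 0 j * (eta 0 j - lam 0 j).
  by move=> /mu_conf; rewrite rowB.
have mu_eta0 j : lam 0 j = 0 -> mu 0 j != 0 -> 0 < mu 0 j * eta 0 j.
  by move=> l0 /mu_eta; rewrite l0 subr0.
have inactive_mu j : ~~ active j -> mu 0 j = 0.
  move=> nj; apply/eqP; apply/negPn/negP => /(mu_eta0 j (inactive_lam nj)).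
  by rewrite (inactive_eta nj) mulr0 ltxx.
have [compl eg eEC] := eta_normal.
have ge0 (c : Y) i : (c 0 (idx_g i) != 0 -> 0 < c 0 (idx_g i) * eta 0 (idx_g i)) ->
    0 <= c 0 (idx_g i).
  have [->//|ci /(_ isT) H] := eqVneq (c 0 (idx_g i)) 0.
  exact: ltW (same_sign_gt0 H (eg i)).
split.
- move=> i; rewrite lg_of; split=> [_|nI]; first by apply: ge0; exact: lam_eta.
  by apply: inactive_lam; apply/negP => /active_Igu.
- by move=> i /inactive_H; rewrite lH_of; exact: inactive_lam.
- by move=> i /inactive_G; rewrite lG_of; exact: inactive_lam.
- by move=> i _; rewrite lG_of lH_of; apply: EC_conformal (eEC i) _ _; exact: lam_eta.
- move=> i; rewrite !lg_of; split=> [_ l0|nI]; first by apply: ge0; exact: mu_eta0.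
  by apply: inactive_mu; apply/negP => /active_Igu.
- by move=> i /inactive_H; rewrite lH_of; exact: inactive_mu.
- by move=> i /inactive_G; rewrite lG_of; exact: inactive_mu.
- move=> i _; rewrite !lG_of !lH_of => lG0 lH0.
  by apply: EC_conformal (eEC i) _ _; exact: mu_eta0.
- move=> i _; rewrite !lG_of !lH_of => lG0; have [lH0|lH0] := eqVneq (lam 0 (idx_H i)) 0.
    by rewrite lH0 ltxx; split.
  by apply: EC_increment (eEC i) (lam_eta lH0) _; exact: mu_eta0.
- move=> i _; rewrite !lG_of !lH_of => lH0; have [lG0|lG0] := eqVneq (lam 0 (idx_G i)) 0.
    by rewrite lG0 ltxx; split.
  by apply: EC_increment (EC_normalC (eEC i)) (lam_eta lG0) _; exact: mu_eta0.
- by rewrite (gradL_of standing) scale1r.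
- rewrite (gradL_of standing) scale0r add0r (hessL_of standing) scale1r dstat.
  by rewrite subrr.
Qed.

(** A multiple of [u] is added to [nu] to satisfy the inequalities that are tight at
    [xb] but decrease along [u]; it changes nothing on the active coordinates.
    Where the multiplier is nonzero the constraint is tight at the nearby point,
    so [s] vanishes there and the last equation follows from stationarity. *)
Lemma second_order_of_pattern (s : Y) (nu : X) :
  (forall j, active j -> s 0 j != 0 -> 0 < s 0 j * y 0 j) ->
  (forall j, active j -> s 0 j = dot (gb j) nu + quad (Hb j) u) ->
  gradf p xb wb + \sum_j lam 0 j *: gb j = 0 ->
  exists nu', second_order_system p xb wb u (multiplier_of lam) nu'.
Proof.
move=> s_y s_eq stat.
have [Tg Th TG TH TGH] := Tlin_of_pattern.
have [yg yh yGH] := (PsetP y).1 Py; have [yg0 yh0 yGH0] := (PsetP yb).1 feas.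
have [b bP] : exists b, forall i, dot (gb (idx_g i)) u < 0 ->
    dot (gb (idx_g i)) nu + b * dot (gb (idx_g i)) u + quad (Hb (idx_g i)) u <= 0.
  have : \forall b \near +oo, forall i, dot (gb (idx_g i)) u < 0 ->
      dot (gb (idx_g i)) nu + b * dot (gb (idx_g i)) u + quad (Hb (idx_g i)) u <= 0.
    apply: filter_forall => i.
    pose b0 := (dot (gb (idx_g i)) nu + quad (Hb (idx_g i)) u) / - dot (gb (idx_g i)) u.
    apply: filterS (nbhs_pinfty_ge (num_real b0)) => b bb0 di.
    by move: bb0; rewrite /b0 ler_pdivrMr ?oppr_gt0//; lra.
  by move=> /filter_ex[b Hb]; exists b.
pose nu' := nu + b *: u; exists nu'.
have s_eq' j : active j -> s 0 j = dot (gb j) nu' + quad (Hb j) u.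
  move=> aj; rewrite s_eq// /nu' dotDr dotZr; move: aj => /andP[_ /eqP ->].
  by rewrite mulr0 addr0.
have s_le0 j : active j -> y 0 j <= 0 -> s 0 j <= 0.
  move=> aj yj; have [->//|sj] := eqVneq (s 0 j) 0.
  exact: ltW (same_sign_lt0 (s_y j aj sj) yj).
have s_eq0 j : active j -> y 0 j = 0 -> s 0 j = 0.
  move=> aj y0; apply/eqP; apply/negPn/negP => /(s_y j aj).
  by rewrite y0 mulr0 ltxx.
have prod0 i : y 0 (idx_G i) * y 0 (idx_H i) = 0 by case: (yGH i).
have sG i : active (idx_G i) ->
    dG p xb wb i nu' + d2G p xb wb i u = - s 0 (idx_G i).
  by move=> aj; rewrite (dGE standing) (d2GE standing) -opprD s_eq'.
have sH i : active (idx_H i) ->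
    dH p xb wb i nu' + d2H p xb wb i u = - s 0 (idx_H i).
  by move=> aj; rewrite (dHE standing) (d2HE standing) -opprD s_eq'.
split.
- move=> i Ii; rewrite dgE d2gE.
  have yi : yb 0 (idx_g i) = 0 by rewrite yb_g.
  have := Tg i Ii; rewrite dgE le_eqVlt => /orP[/eqP di|di].
    have ai : active (idx_g i) by rewrite /active yi di !eqxx.
    by rewrite -s_eq'//; exact: s_le0.
  by rewrite /nu' dotDr dotZr; exact: bP.
- move=> i; rewrite dhE d2hE.
  have ai : active (idx_h i) by rewrite /active yh0 -dhE Th !eqxx.
  by rewrite -s_eq'//; exact: s_eq0.
- move=> i Ii; have yH := inactive_neq0 (inactive_H Ii).
  have yG : y 0 (idx_G i) = 0.
    by move/eqP: (prod0 i); rewrite mulf_eq0 (negbTE yH) orbF => /eqP.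
  have ai : active (idx_G i).
    rewrite /active yb_G oppr_eq0 -[dot _ _ == 0]oppr_eq0 -(dGE standing).
    case: Ii => [[G0 H0]|[[G0 _] dG0 _]]; last by rewrite G0 dG0 !eqxx.
    by rewrite G0 (TG i (conj G0 H0)) !eqxx.
  by rewrite sG// (s_eq0 _ ai yG) oppr0.
- move=> i Ii; have yG := inactive_neq0 (inactive_G Ii).
  have yH : y 0 (idx_H i) = 0.
    by move/eqP: (prod0 i); rewrite mulf_eq0 (negbTE yG) => /eqP.
  have ai : active (idx_H i).
    rewrite /active yb_H oppr_eq0 -[dot _ _ == 0]oppr_eq0 -(dHE standing).
    case: Ii => [[G0 H0]|[[_ H0] _ dH0]]; last by rewrite H0 dH0 !eqxx.
    by rewrite H0 (TH i (conj G0 H0)) !eqxx.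
  by rewrite sH// (s_eq0 _ ai yH) oppr0.
- move=> i Ii.
  have [aG aH] := active_I00u Ii.
  have opp (a a' : R) : a = - a' -> - a = a' by move=> ->; rewrite opprK.
  have -> : - row2 (dG p xb wb i nu' + d2G p xb wb i u) (dH p xb wb i nu' + d2H p xb wb i u)
      = row2 (s 0 (idx_G i)) (s 0 (idx_H i)).
    by apply/rowP => j; rewrite !mxE; case: ifP => _; [exact: opp (sG i aG)|exact: opp (sH i aH)].
  apply/QEC_tangent_apex/QEC_row2; have [yG yH _] := yGH i.
  split; [exact: s_le0|exact: s_le0|].
  apply/eqP; rewrite mulf_eq0; apply/negPn/negP; rewrite negb_or => /andP[sG0 sH0].
  have := same_sign_neq0 (s_y _ aG sG0); have := same_sign_neq0 (s_y _ aH sH0).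
  by move/eqP: (prod0 i); rewrite mulf_eq0 => /orP[] ->.
- have f_eq : gradf p xb wb = - \sum_j lam 0 j *: gb j.
    by apply/eqP; rewrite -addr_eq0 stat.
  rewrite /quad (hessL_of standing) scale0r add0r f_eq dotNl.
  have dot_suml (v : 'I_N -> X) (w : X) :
      dot (\sum_j lam 0 j *: v j) w = \sum_j lam 0 j * dot (v j) w.
    elim/big_ind2: _ => [|a a' c c' <- <-|j _]; rewrite ?dot0l ?dotDl ?dotZl//.
  rewrite !dot_suml -sumrN; apply: eq_bigr => j _.
  have [->|lj] := eqVneq (lam 0 j) 0; first by rewrite !mul0r oppr0.
  have [aj yj] := lam_neq0_active lj.
  have := s_eq' j aj; rewrite (s_eq0 _ aj yj) -mulrN => /esym/eqP.
  by rewrite addrC addr_eq0 => /eqP <-.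
Qed.

End SignPattern.

(** * The contradiction *)

Section BadFilter.
Variables (R : realType) (Omega : topologicalType) (n mI mE mC : nat).
Variables (p : mpec R Omega n mI mE mC) (xb : 'rV[R]_n) (wb : Omega) (l : nat).
Local Notation X := 'rV[R]_n.
Local Notation t z := (enorm (z.1 - xb)).

Definition far_solution (L : R) (z : X * Omega) : Prop :=
  (Sol p z.2 `|` SolM p z.2) z.1 /\ L * tau p xb wb l z.2 < t z.

(** Generated by the neighbourhoods of [(xb, wb)] and the sets of solutions that
    violate the bound with constant [L]. The parameter space need not be first
    countable, so sequences of counterexamples are replaced by this filter. *)
Definition far_filter : set_system (X * Omega) :=
  [set S | exists2 L, 0 < L & \forall z \near (xb, wb), far_solution L z -> S z].

Lemma tau_ge0 w : 0 <= tau p xb wb l w.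
Proof. exact: le_trans (err_ge0 _ _ _ _ _) (err_le_tau _ _ _ _ _). Qed.

Lemma far_solutionW L L' z : L <= L' -> far_solution L' z -> far_solution L z.
Proof.
move=> LL' [Sz tz]; split => //; apply: le_lt_trans tz.
by rewrite ler_wpM2r// tau_ge0.
Qed.

Lemma ball_of_not_far L w x : 0 < L -> (Sol p w `|` SolM p w) x ->
  ~ far_solution L (x, w) ->
  [set xb + (L * tau p xb wb l w) *: b | b in @eball R n] x.
Proof.
move=> L0 Sx nfar; have {nfar} : enorm (x - xb) <= L * tau p xb wb l w.
  by rewrite leNgt; apply/negP => lt; apply: nfar.
set c := L * _ => xc.
have c0 : 0 <= c by rewrite mulr_ge0 ?tau_ge0 ?(ltW L0).
have [c00|cn0] := eqVneq c 0.
  exists 0; first by rewrite /eball/= enorm0.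
  move: xc; rewrite c00 scale0r addr0 => xc; apply/esym/eqP; rewrite -subr_eq0.
  by apply/eqP/enorm_eq0/eqP; rewrite eq_le xc enorm_ge0.
have cp : 0 < c by rewrite lt_neqAle eq_sym cn0.
exists (c^-1 *: (x - xb)); last by rewrite scalerA divff// scale1r addrC subrK.
by rewrite /eball/= enormZ normfV gtr0_norm// ler_pdivrMl// mulr1.
Qed.

Lemma far_filter_proper :
  ~ (exists (U : set X) (W : set Omega) (L : R),
     [/\ nbhs xb U, nbhs wb W, 0 < L &
       forall w, W w -> (Sol p w `|` SolM p w) `&` U `<=`
         [set xb + (L * tau p xb wb l w) *: b | b in @eball R n]]) ->
  ProperFilter far_filter.
Proof.
move=> no_bound; split.
  move=> [L L0 [[U W] /= [nU nW] UW]]; apply: no_bound; exists U, W, L; split => //.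
  move=> w Ww x [Sx Ux]; apply: ball_of_not_far => // far.
  exact: (UW (x, w) (conj Ux Ww) far).
split.
- by exists 1 => //; apply: filterE => z _.
- move=> A B [L L0 HA] [L' L'0 HB]; exists (Num.max L L'); first by rewrite lt_max L0.
  apply: filterS (filterI HA HB) => z /= [Az Bz] far; split.
    by apply: Az; apply: far_solutionW far; rewrite le_max lexx.
  by apply: Bz; apply: far_solutionW far; rewrite le_max lexx orbT.
- by move=> A B AB [L L0 HA]; exists L => //; apply: filterS HA => z Az /Az/AB.
Qed.

Lemma far_filter_nbhs : nbhs (xb, wb) `<=` far_filter.
Proof. by move=> A nA; exists 1 => //; apply: filterS nA. Qed.

Lemma far_filter_far L : 0 < L -> far_filter (far_solution L).
Proof. by move=> L0; exists L => //; apply: filterE. Qed.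

End BadFilter.

Section Assembly.
Variables (R : realType) (Omega : topologicalType) (n mI mE mC : nat).
Variables (p : mpec R Omega n mI mE mC) (xb : 'rV[R]_n) (wb : Omega) (l : nat).
Local Notation X := 'rV[R]_n.
Local Notation N := (mI + (mE + (mC + mC)))%N.
Local Notation Y := 'rV[R]_N.
Local Notation t z := (enorm (z.1 - xb)).
Local Notation q j w := (fun y => constraint p j (y, w)).
Local Notation gb j := (grad (q j wb) xb).
Local Notation Hb j := (hess (q j wb) xb).
Local Notation yb := (mq p (xb, wb)).
Hypothesis standing : standing_assumption p xb wb.
Hypothesis feas : feasible p wb xb.
Hypothesis l0 : (0 < l)%N.
Hypothesis regular : property_R p xb wb l.
Variable F : set_system (X * Omega).
Context {FU : UltraFilter F}.
Hypothesis Fnear : nbhs (xb, wb) `<=` F.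
Hypothesis Ffar : forall L, 0 < L -> F (far_solution p xb wb l L).

Lemma scale_gt0 : \forall z \near F, 0 < t z.
Proof.
apply: filterS (Ffar ltr01) => z [_]; apply: le_lt_trans.
by rewrite mul1r tau_ge0.
Qed.

Lemma tau_small e : 0 < e -> \forall z \near F, tau p xb wb l z.2 <= e * t z.
Proof.
move=> e0; have e1 : 0 < e^-1 by rewrite invr_gt0.
apply: filterS (Ffar e1) => z [_ /ltW].
by rewrite mulrC ler_pdivrMr// mulrC.
Qed.

Lemma direction_exists : exists u : X,
  u != 0 /\ (t z)^-1 *: (z.1 - xb) @[z --> F] --> u.
Proof.
have n1 : \forall z \near F, enorm ((t z)^-1 *: (z.1 - xb)) = 1.
  apply: filterS scale_gt0 => z tz.
  by rewrite enormZ normfV gtr0_norm// mulVf// gt_eqF.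
have [u uP] : exists u : X, (t z)^-1 *: (z.1 - xb) @[z --> F] --> u.
  apply: (@ultra_cvg_bounded _ _ F _ _ _ 1); apply: filterS n1 => z <-.
  exact: normr_le_enorm.
exists u; split => //; apply/eqP => u0.
have : enorm ((t z)^-1 *: (z.1 - xb)) - 1 @[z --> F] --> enorm u - 1.
  by apply: cvgB; [exact: cvg_enorm|exact: cvg_cst].
move=> /cvg_eq0 H; suff : enorm u - 1 = 0 by rewrite u0 enorm0; lra.
by apply: H; apply: filterS n1 => z ->; rewrite subrr.
Qed.

Lemma feasible_near : \forall z \near F, @Pset R mI mE mC (mq p z).
Proof.
by apply: filterS (Ffar ltr01) => -[x w] [[[xi [Fx _] _]|[eta [Py _] _]] _].
Qed.

(** Choose the residual tolerance [t z ^+ 2] at [z], negligible against the scale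
    [t z] of the blow-up. *)
Lemma multipliers_exist : exists (eta : X * Omega -> Y) (lam : Y),
  [/\ \forall z \near F, normal_signs (mq p z) (eta z),
      \forall z \near F, enorm (gradf p z.1 z.2 +
        \sum_j eta z 0 j *: grad (q j z.2) z.1) <= t z ^+ 2 &
      eta z @[z --> F] --> lam].
Proof.
have [U [W [kappa [gamma [nU nW k0 g0 mr]]]]] := regular.
pose good z eta := [/\ normal_signs (mq p z) eta,
  enorm (gradf p z.1 z.2 + eta *m (jacq p z.1 z.2)^T) <= t z ^+ 2 &
  enorm eta <= kappa * (enorm (gradf p z.1 z.2) + t z ^+ 2)].
have ex_good z : exists eta, (exists eta', good z eta') -> good z eta.
  by have [[eta' H]|nH] := pselect (exists eta', good z eta'); [exists eta'|exists 0].
have [eta etaP] := choice ex_good.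
have UW : \forall z \near F, U z.1 /\ W z.2 by apply: Fnear; exists (U, W).
have sn := Fnear (standing_near standing).
have good_near : \forall z \near F, good z (eta z).
  apply: filterS (filterI (filterI (Ffar g0) (filterI UW sn)) (filterI scale_gt0 feasible_near)).
  move=> [x w] /= [[[Sx far] [[Ux Ww] [_ _ dq _]]] [tx Px]]; apply: etaP.
  apply: approximate_multiplier => //; first by rewrite exprn_gt0.
  apply: mr => //; apply: le_lt_trans far.
  by rewrite ler_wpM2l ?(ltW g0)// err_le_tau.
have gf : gradf p z.1 z.2 @[z --> F] --> gradf p xb wb.
  have [_ [_ [_ _ _ [_ gc _ _ _] _]]] := standing.
  by apply: cvg_trans gc; exact: cvg_app.
have gfb : \forall z \near F, enorm (gradf p z.1 z.2) < enorm (gradf p xb wb) + 1.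
  by apply: (cvgr_lt _ (cvg_enorm gf)); rewrite ltrDl.
have t1 : \forall z \near F, t z < 1.
  by apply: (cvgr_lt _ (blowup_scale_cvg0 Fnear)).
have [lam lamP] : exists lam : Y, eta z @[z --> F] --> lam.
  apply: (@ultra_cvg_bounded _ _ F _ _ _ (kappa * (enorm (gradf p xb wb) + 1 + 1))).
  apply: filterS (filterI good_near (filterI gfb t1)) => z /= [[_ _ b] [g1 tz]].
  apply: (le_trans (normr_le_enorm _)); apply: (le_trans b).
  rewrite ler_pM2l// lerD ?(ltW g1)// expr_le1// ?enorm_ge0//.
  exact: ltW.
exists eta, lam; split => //; first by apply: filterS good_near => z [].
apply: filterS (filterI good_near sn) => z /= [[_ + _] [_ _ dq _]].
congr (_ <= _); congr (enorm (_ + _)).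
rewrite mulmx_sum_row; apply: eq_bigr => j _; congr (_ *: _).
by rewrite -tr_col -(grad_coord j dq).
Qed.

(** All sign information is read off at a single point of the ultrafilter, where
    the limits [u], [lam], [mu] and [s] have signs present in the corresponding
    data; [lam] does not depend on that point, so the first- and second-order
    systems share it. *)
Lemma systems_exist : exists (u : X) (lam mu : Y),
  [/\ u != 0, Tlin p xb wb u,
      first_order_system p xb wb u (multiplier_of lam) (multiplier_of mu) &
      l = 2%N -> exists nu, second_order_system p xb wb u (multiplier_of lam) nu].
Proof.
have [u [u0 u_lim]] := direction_exists.
have [eta [lam [eta_normal res lam_lim]]] := multipliers_exist.
have PF : ProperFilter F by exact: ultra_proper.
have tpos := scale_gt0; have tlim := blowup_scale_cvg0 (FF := PF) Fnear.
have aq := objective_quotient (FF := PF) standing Fnear tpos u_lim tau_small.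
have gq j := constraint_quotient (FF := PF) standing Fnear tpos u_lim tau_small (j := j).
have stat := multiplier_limit (FF := PF) tpos tlim aq gq lam_lim res.
have incr := multiplier_increment (FF := PF) tpos tlim aq gq lam_lim res.
pose pattern z := [/\ forall j, yb 0 j != 0 -> 0 < yb 0 j * mq p z 0 j,
  forall j, yb 0 j = 0 -> dot (gb j) u != 0 -> 0 < dot (gb j) u * mq p z 0 j,
  normal_signs (mq p z) (eta z), conformal lam (eta z) & @Pset R mI mE mC (mq p z)].
have pattern_near : \forall z \near F, pattern z.
  have y_lim j : constraint p j z @[z --> F] --> yb 0 j.
    have [_ [_ [_ _ _ [qc _ _ _ _] _]]] := standing.
    have mqc : mq p z @[z --> F] --> yb by apply: cvg_trans qc; exact: cvg_app.
    by move/cvg_rowP : mqc; exact.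
  have n1 : \forall z \near F, forall j, yb 0 j != 0 -> 0 < yb 0 j * mq p z 0 j.
    apply: filter_forall => j; have [j0|j0] := eqVneq (yb 0 j) 0.
      by apply: filterE.
    by apply: filterS (cvg_same_sign (@y_lim j) j0).
  have n2 : \forall z \near F, forall j, yb 0 j = 0 -> dot (gb j) u != 0 ->
      0 < dot (gb j) u * mq p z 0 j.
    apply: filter_forall => j; have [j0|j0] := eqVneq (dot (gb j) u) 0.
      by apply: filterE.
    have H := constraint_first_order (FF := PF) standing l0 Fnear tpos u_lim tau_small (j := j).
    apply: filterS (filterI tpos (cvg_same_sign H j0)) => z /= [tz Hz] yj _.
    move: Hz; rewrite [constraint p j (xb, wb)]yj subr0 mulrA pmulr_lgt0// invr_gt0//.
  have n3 : \forall z \near F, conformal lam (eta z).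
    apply: filter_forall => j; have [j0|j0] := eqVneq (lam 0 j) 0.
      by apply: filterE.
    have lam_j : eta z 0 j @[z --> F] --> lam 0 j by move/cvg_rowP : lam_lim; exact.
    by apply: filterS (cvg_same_sign lam_j j0).
  apply: filterS (filterI (filterI n1 n2) (filterI eta_normal (filterI n3 feasible_near))).
  by move=> z [[? ?] [? [? ?]]].
have [mu muB mu_conf] : exists2 mu : Y,
    \sum_j mu 0 j *: gb j = - (u *m hessf p xb wb + \sum_j lam 0 j *: (u *m Hb j)) &
    \forall z \near F, conformal mu (eta z - lam).
  pose B : 'M[R]_(N, n) := \matrix_j gb j.
  have BE (c : Y) : c *m B = \sum_j c 0 j *: gb j.
    by rewrite mulmx_sum_row; apply: eq_bigr => j _; rewrite rowK.
  have lim : ((t z)^-1 *: (eta z - lam)) *m B @[z --> F] -->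
      - (u *m hessf p xb wb + \sum_j lam 0 j *: (u *m Hb j)).
    by under eq_fun do rewrite BE; exact: incr.
  have [mu muB mu_conf] := conformal_limit (GU := FU) lim.
  exists mu; first by rewrite -BE.
  apply: filterS (filterI tpos mu_conf) => z /= [tz H] j mj.
  by have := H j mj; rewrite mxE mulrCA pmulr_rgt0// invr_gt0.
have [z [/= [y1 y2 y3 y4 y5] muz]] := filter_ex (filterI pattern_near mu_conf).
exists u, lam, mu; split => //.
- exact: (Tlin_of_pattern standing feas y5 y1 y2).
- exact: (first_order_of_pattern standing y1 y2 y3 y4 muz stat muB).
move=> l2.
have [s [nu [s_eq s_conf]]] : exists (s : Y) (nu : X),
   (forall j, active p xb wb u j -> s 0 j = dot (gb j) nu + quad (Hb j) u) /\
   \forall z \near F, forall j, active p xb wb u j -> s 0 j != 0 -> 0 < s 0 j * mq p z 0 j.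
  (* The slack [s] and the direction [nu] are limits of one conformal family:
     [sz z - nuz z *m K] converges although neither term need be bounded. *)
  pose act j := active p xb wb u j.
  pose K : 'M[R]_(n, N) := \matrix_(i, j) (if act j then gb j 0 i else 0).
  pose sz z : Y := \row_j (if act j then
    2 * ((constraint p j z - constraint p j (xb, wb)) / t z ^+ 2) else 0).
  pose nuz (z : X * Omega) : X := 2 *: ((t z)^-1 *: ((t z)^-1 *: (z.1 - xb) - u)).
  pose w : Y := \row_j (if act j then quad (Hb j) u else 0).
  pose B : 'M[R]_(N + n, N) := col_mx 1%:M (- K).
  have KE (v : X) j : (v *m K) 0 j = if act j then dot (gb j) v else 0.
    rewrite mxE; case: ifP => aj.
      by rewrite dotC dotE; apply: eq_bigr => i _; rewrite mxE aj.
    by rewrite big1// => i _; rewrite mxE aj mulr0.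
  have BE (c : Y) (v : X) : row_mx c v *m B = c - v *m K.
    by rewrite mul_row_col mulmx1 mulmxN.
  have lim : row_mx (sz z) (nuz z) *m B @[z --> F] --> w.
    apply/cvg_rowP => j; rewrite mxE; under eq_fun do rewrite BE rowB KE mxE.
    case: ifP => aj; last by under eq_fun do rewrite subr0; exact: cvg_cst.
    have /andP[_ /eqP dj] := aj.
    exact: (constraint_curvature (FF := PF) standing l0 Fnear tpos u_lim tau_small l2 dj).
  have [c cB c_conf] := conformal_limit (GU := FU) lim.
  exists (lsubmx c), (rsubmx c); split.
    move=> j aj; move: cB; rewrite -{1}(hsubmxK c) BE => /rowP/(_ j).
    by rewrite rowB KE [w _ _]mxE /act aj => /eqP; rewrite subr_eq addrC => /eqP.
  apply: filterS (filterI tpos c_conf) => v /= [tv H] j aj.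
  rewrite mxE => cj; have := H _ cj; rewrite row_mxEl mxE /act aj.
  have /andP[/eqP yj _] := aj.
  rewrite [constraint p j (xb, wb)]yj subr0 !mulrA pmulr_lgt0 ?invr_gt0 ?exprn_gt0//.
  by rewrite mulrAC pmulr_lgt0.
have [z' [/= [z1 z2 z3 z4 z5] sz]] := filter_ex (filterI pattern_near s_conf).
exact: (second_order_of_pattern standing feas z5 z1 z2 z3 z4 sz s_eq stat).
Qed.

End Assembly.

Theorem corollary3 (R : realType) (Omega : topologicalType) (n mI mE mC : nat)
    (p : mpec R Omega n mI mE mC) (xb : 'rV[R]_n) (wb : Omega) :
  mpec_continuous p ->
  standing_assumption p xb wb ->
  feasible p wb xb ->
  (property_R p xb wb 1%N ->
   ~ (exists (u : 'rV[R]_n) (lam mu : multiplier R mI mE mC),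
        [/\ u != 0, Tlin p xb wb u & first_order_system p xb wb u lam mu]) ->
   exists (U : set 'rV[R]_n) (W : set Omega) (L : R),
     [/\ nbhs xb U, nbhs wb W, 0 < L &
       forall w, W w ->
         (Sol p w `|` SolM p w) `&` U `<=`
         [set xb + (L * tau p xb wb 1%N w) *: b | b in @eball R n]])
  /\
  (property_R p xb wb 2%N ->
   ~ (exists (u : 'rV[R]_n) (lam mu : multiplier R mI mE mC) (nu : 'rV[R]_n),
        [/\ u != 0, Tlin p xb wb u, first_order_system p xb wb u lam mu &
            second_order_system p xb wb u lam nu]) ->
   exists (U : set 'rV[R]_n) (W : set Omega) (L : R),
     [/\ nbhs xb U, nbhs wb W, 0 < L &
       forall w, W w ->
         (Sol p w `|` SolM p w) `&` U `<=`
         [set xb + (L * tau p xb wb 2%N w) *: b | b in @eball R n]]).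
Proof.
move=> _ standing feas; split=> reg none; apply: contrapT => /far_filter_proper PF.
- have [F [FU sF]] := ultraFilterLemma PF.
  have [u [lam [mu [u0 Tu fo _]]]] := systems_exist standing feas (ltn0Sn 0) reg
    (subset_trans (@far_filter_nbhs _ _ _ _ _ _ _ _ _ _) sF)
    (fun L L0 => sF _ (far_filter_far _ _ _ _ L0)).
  by apply: none; exists u, (multiplier_of lam), (multiplier_of mu).
- have [F [FU sF]] := ultraFilterLemma PF.
  have [u [lam [mu [u0 Tu fo so]]]] := systems_exist standing feas (ltn0Sn 1) reg
    (subset_trans (@far_filter_nbhs _ _ _ _ _ _ _ _ _ _) sF)
    (fun L L0 => sF _ (far_filter_far _ _ _ _ L0)).
  have [nu sonu] := so erefl.
  by apply: none; exists u, (multiplier_of lam), (multiplier_of mu), nu.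
Qed.
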